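(* There exists an algorithm and, for every $\epsilon,\alpha>0$, a constant $C(\epsilon,\alpha)$ such that the following holds. Given $\epsilon,\alpha>0$ and a bipartite graph $G$ between vertex sets $X$ and $Y$, each of size at most $n$, the algorithm runs in time at most $C(\epsilon,\alpha)n^2$ and outputs one of the following: (1) it correctly states that $G$ is $\epsilon$-regular; or (2) it finds vertex subsets $U\subseteq X$ and $W\subseteq Y$ with $|U|\ge(1-\alpha)\epsilon|X|$, $|W|\ge(1-\alpha)\epsilon|Y|$, and $|d(U,W)-d(X,Y)|>(1-\alpha)\epsilon$ (so that $(U,W)$ witnesses that $G$ is not $(1-\alpha)\epsilon$-regular).
   Context: For vertex subsets $U,W$, $e(U,W)$ denotes the number of pairs $(u,w)\in U\times W$ that are edges, and $d(U,W)=e(U,W)/(|U||W|)$. A pair $(X,Y)$ is $\epsilon$-regular if for all $X'\subseteq X$, $Y'\subseteq Y$ with $|X'|\ge\epsilon|X|$ and $|Y'|\ge\epsilon|Y|$ we have $|d(X',Y')-d(X,Y)|<\epsilon$. A bipartite graph $G$ with bipartition $(X,Y)$ is called $\epsilon$-regular if the pair $(X,Y)$ is $\epsilon$-regular. *)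

(* Defs.v *)
From HB Require Import structures.
From mathcomp Require Import all_boot all_order all_algebra.
From mathcomp Require Import reals.
Set Implicit Arguments.
Unset Strict Implicit.
Unset Printing Implicit Defensive.
Import Order.TTheory GRing.Theory Num.Theory.
Local Open Scope ring_scope.

Section Regularity.
Variables (R : realType) (X Y : finType) (G : X -> Y -> bool).
Implicit Types (U A : {set X}) (W B : {set Y}).

Definition edge_count U W : nat :=
  #|[set p : X * Y | [&& p.1 \in U, p.2 \in W & G p.1 p.2]]|.

(* Division by zero gives 0, so a pair with an empty side has density 0. *)
Definition density U W : R := (edge_count U W)%:R / (#|U|%:R * #|W|%:R).

Definition regular_pair (eps : R) A B : Prop :=
  forall A' B', A' \subset A -> B' \subset B ->
    eps * #|A|%:R <= #|A'|%:R -> eps * #|B|%:R <= #|B'|%:R ->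
    `|density A' B' - density A B| < eps.

Definition regular_bigraph (eps : R) : Prop :=
  regular_pair eps [set: X] [set: Y].

(* Nonemptiness is what makes d(U, W) meaningful; it follows from the other
   conditions when 0 < eps and alpha < 1. *)
Definition irregularity_witness (eps alpha : R) U W : Prop :=
  [/\ U != set0 /\ W != set0,
      (1 - alpha) * eps * #|X|%:R <= #|U|%:R,
      (1 - alpha) * eps * #|Y|%:R <= #|W|%:R &
      (1 - alpha) * eps < `|density U W - density [set: X] [set: Y]| ].

End Regularity.

(* Model of computation: a real RAM.  The memory consists of arrays named by
   natural numbers; [imem s a i] is cell [i] of the integer array [a], holding a
   word of [w] bits, and [rmem s a i] is cell [i] of the real array [a], holding
   an exact real number.  A scalar variable is cell 0 of some array.  Integers
   can be converted to reals but not conversely: there is no floor operation, and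
   reals influence integers only through comparisons. *)

Inductive iexp : Type :=
| ILit of nat
| IGet of nat & iexp
| IAdd of iexp & iexp
| ISub of iexp & iexp
| IMul of iexp & iexp
| IDiv of iexp & iexp
| IMod of iexp & iexp.

(* The only literals are natural numbers, so that the program text cannot carry
   information about eps and alpha. *)
Inductive rexp : Type :=
| RInt of iexp
| RGet of nat & iexp
| RAdd of rexp & rexp
| RSub of rexp & rexp
| RMul of rexp & rexp
| RDiv of rexp & rexp.

Inductive bexp : Type :=
| BLei of iexp & iexp
| BLer of rexp & rexp
| BNot of bexp
| BAnd of bexp & bexp.

Inductive cmd : Type :=
| Skip
| ISet of nat & iexp & iexp  (* ISet a i e : the integer cell a[i] := e *)
| RSet of nat & iexp & rexp
| Seq of cmd & cmd
| If of bexp & cmd & cmd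
| While of bexp & cmd.

Record state (R : realType) : Type :=
  State { imem : nat -> nat -> nat; rmem : nat -> nat -> R }.

Definition upd (T : Type) (m : nat -> nat -> T) (a i : nat) (v : T) :=
  fun b j => if (b == a) && (j == i) then v else m b j.

Section Semantics.
Variables (R : realType) (w : nat).
Implicit Type s : state R.

(* Overflow wraps around modulo 2 ^ w, subtraction is truncated at 0. *)
Fixpoint ieval s (e : iexp) : nat :=
  match e with
  | ILit n => (n %% 2 ^ w)%N
  | IGet a i => imem s a (ieval s i)
  | IAdd e1 e2 => ((ieval s e1 + ieval s e2) %% 2 ^ w)%N
  | ISub e1 e2 => (ieval s e1 - ieval s e2)%N
  | IMul e1 e2 => ((ieval s e1 * ieval s e2) %% 2 ^ w)%N
  | IDiv e1 e2 => (ieval s e1 %/ ieval s e2)%N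
  | IMod e1 e2 => (ieval s e1 %% ieval s e2)%N
  end.

Fixpoint reval s (e : rexp) : R :=
  match e with
  | RInt i => (ieval s i)%:R
  | RGet a i => rmem s a (ieval s i)
  | RAdd e1 e2 => reval s e1 + reval s e2
  | RSub e1 e2 => reval s e1 - reval s e2
  | RMul e1 e2 => reval s e1 * reval s e2
  | RDiv e1 e2 => reval s e1 / reval s e2
  end.

Fixpoint beval s (b : bexp) : bool :=
  match b with
  | BLei e1 e2 => (ieval s e1 <= ieval s e2)%N
  | BLer e1 e2 => reval s e1 <= reval s e2
  | BNot b1 => ~~ beval s b1
  | BAnd b1 b2 => beval s b1 && beval s b2
  end.

(* Unit cost: every operation, memory access and literal takes one step. *)
Fixpoint icost (e : iexp) : nat :=
  match e with
  | ILit _ => 1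
  | IGet _ i => (icost i).+1
  | IAdd e1 e2 | ISub e1 e2 | IMul e1 e2 | IDiv e1 e2 | IMod e1 e2 =>
      (icost e1 + icost e2).+1
  end.

Fixpoint rcost (e : rexp) : nat :=
  match e with
  | RInt i | RGet _ i => (icost i).+1
  | RAdd e1 e2 | RSub e1 e2 | RMul e1 e2 | RDiv e1 e2 =>
      (rcost e1 + rcost e2).+1
  end.

Fixpoint bcost (b : bexp) : nat :=
  match b with
  | BLei e1 e2 => (icost e1 + icost e2).+1
  | BLer e1 e2 => (rcost e1 + rcost e2).+1
  | BNot b1 => (bcost b1).+1
  | BAnd b1 b2 => (bcost b1 + bcost b2).+1
  end.

(* [exec c s s' t]: started in [s], the program [c] halts in [s'] after exactly
   [t] steps. *)
Inductive exec : cmd -> state R -> state R -> nat -> Prop :=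
| ExecSkip s : exec Skip s s 1
| ExecISet s a i e :
    exec (ISet a i e) s
      (State (upd (imem s) a (ieval s i) (ieval s e)) (rmem s))
      (icost i + icost e).+1
| ExecRSet s a i e :
    exec (RSet a i e) s
      (State (imem s) (upd (rmem s) a (ieval s i) (reval s e)))
      (icost i + rcost e).+1
| ExecSeq s1 s2 s3 c1 c2 t1 t2 :
    exec c1 s1 s2 t1 -> exec c2 s2 s3 t2 -> exec (Seq c1 c2) s1 s3 (t1 + t2)%N
| ExecIfTrue s s' b c1 c2 t :
    beval s b -> exec c1 s s' t -> exec (If b c1 c2) s s' (bcost b + t).+1
| ExecIfFalse s s' b c1 c2 t :
    ~~ beval s b -> exec c2 s s' t -> exec (If b c1 c2) s s' (bcost b + t).+1
| ExecWhileFalse s b c :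
    ~~ beval s b -> exec (While b c) s s (bcost b).+1
| ExecWhileTrue s1 s2 s3 b c t1 t2 :
    beval s1 b -> exec c s1 s2 t1 -> exec (While b c) s2 s3 t2 ->
    exec (While b c) s1 s3 (bcost b + t1 + t2).+1.

(* Hence a program has at most one outcome and running time on each input. *)
Lemma exec_det c s s1 s2 t1 t2 :
  exec c s s1 t1 -> exec c s s2 t2 -> s1 = s2 /\ t1 = t2.
Proof.
move=> H; elim: H s2 t2 => {c s s1 t1};
  intros; match goal with H : exec _ _ _ _ |- _ => inversion H; subst end => //;
  repeat match goal with
  | IH : forall s t, exec ?c ?s0 s t -> _, H : exec ?c ?s0 _ _ |- _ =>
      case: (IH _ _ H) => ? ?; subst; clear H
  | H1 : is_true (beval ?s ?b), H2 : is_true (~~ beval ?s ?b) |- _ =>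
      by rewrite H1 in H2
  end; by [].
Qed.

End Semantics.

Section InputOutput.
Variables (R : realType) (p q : nat) (G : 'I_p -> 'I_q -> bool).

(* Integer array 0 is p, q; integer array 1 is the p x q adjacency matrix in
   row-major order; real array 0 is eps, alpha.  All other cells are 0. *)
Definition input_state (eps alpha : R) : state R :=
  State
    (fun a k =>
       match a with
       | 0%N => nth 0%N [:: p; q] k
       | 1%N => [exists i : 'I_p, exists j : 'I_q,
                   (k == i * q + j)%N && G i j] : nat
       | _ => 0%N
       end)
    (fun a k => if a is 0%N then nth 0 [:: eps; alpha] k else 0).

(* Integer cell 2[0] is the verdict, 0 meaning that G is eps-regular; otherwise
   integer arrays 3 and 4 are the characteristic vectors of U and W. *)
Definition claims_regular (s : state R) : bool := imem s 2 0 == 0%N.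
Definition output_U (s : state R) : {set 'I_p} := [set i : 'I_p | imem s 3 i != 0%N].
Definition output_W (s : state R) : {set 'I_q} := [set j : 'I_q | imem s 4 j != 0%N].

Definition correct_output (eps alpha : R) (s : state R) : Prop :=
  if claims_regular s then regular_bigraph G eps
  else irregularity_witness G eps alpha (output_U s) (output_W s).

End InputOutput.

(* Main.v *)
Require Import Defs.
From mathcomp Require Import all_boot all_order all_algebra.
From mathcomp Require Import reals zify ring lra.

(** Let x_i in {0,1}^Y be the rows of the adjacency matrix.  A list of rows is
    halved by pairing its members up and keeping one of each pair, greedily, so
    that inside each block of B pairs the sum of (kept kept^T - dropped dropped^T)
    has small Hilbert-Schmidt norm: each choice makes a cross term nonpositive, so
    the squared norm grows only linearly.  While the length is halved, B grows by a
    factor 3/2, so that the cost (length times B inner products) and the errors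
    (about 1/sqrt B) are both geometric sums; after O(n^2) steps a bounded number of
    rows S remains with sum_i x_i x_i^T close to a multiple of sum_S x x^T in
    entrywise l^1 norm.  Therefore a vector u with entries in [-1,1] that is
    orthogonal to the rows in S satisfies sum_i |<x_i,u>| = o(pq).

    Split Y into atoms according to the pattern on S, and each atom into cells of
    bounded relative size.  Every W is approximated by a union of cells: up to
    o(q) elements the two have the same number of elements in each atom, so their
    indicators differ by a vector orthogonal to S.  There are boundedly many unions
    of cells; for each of them the extremal U of a given size consists of the
    vertices of largest or smallest degree into W, and is tested exactly. *)

Set Implicit Arguments.
Unset Strict Implicit.
Unset Printing Implicit Defensive.
Import Order.TTheory GRing.Theory Num.Theory.
Local Open Scope ring_scope.

(** * A program logic with running times *)

(** The obstacle is the time bound: the usual test for regularity compares all pairs of rows, which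
    amounts to a matrix product and exceeds n^2. A bounded sample makes such comparisons cheap. It
    can be chosen without randomness because exchanging the members of a pair flips the sign of the
    cross term in the squared norm. Approximation affects only one of the two answers. Every
    candidate pair is tested exactly, so a reported witness is right regardless of all estimates;
    the verdict that G is regular rests on the fact that an irregular pair would have produced a
    successful candidate. The factor 1 - alpha pays for this. If |U| >= eps p and |W| is at least
    about eps q, then the room alpha eps |U||W| is of order alpha eps^3 pq, while replacing W by a
    union of cells changes edge counts by O(pq / N). Hence N is the least integer with N eps^3 alpha
    >= 1, with alpha capped at 1/2, and all other constants are functions of N. *)

Fixpoint imods (c : cmd) : seq nat :=
  match c with
  | ISet a _ _ => [:: a]
  | Seq c1 c2 | If _ c1 c2 => imods c1 ++ imods c2
  | While _ c1 => imods c1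
  | _ => [::]
  end.

Fixpoint rmods (c : cmd) : seq nat :=
  match c with
  | RSet a _ _ => [:: a]
  | Seq c1 c2 | If _ c1 c2 => rmods c1 ++ rmods c2
  | While _ c1 => rmods c1
  | _ => [::]
  end.

Definition var (v : nat) : iexp := IGet v (ILit 0).
Definition rvar (v : nat) : rexp := RGet v (ILit 0).
Definition setvar (v : nat) (e : iexp) : cmd := ISet v (ILit 0) e.
Definition rsetvar (v : nat) (e : rexp) : cmd := RSet v (ILit 0) e.

Definition blt (e1 e2 : iexp) : bexp := BNot (BLei e2 e1).

(* [e] is re-evaluated before every iteration. *)
Definition For (v : nat) (e : iexp) (c : cmd) : cmd :=
  Seq (setvar v (ILit 0))
      (While (blt (var v) e) (Seq c (setvar v (IAdd (var v) (ILit 1))))).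

Section Logic.
Variables (R : realType) (w : nat).
Implicit Types (s : state R) (Q : state R -> Prop).

(** Framing is by whole arrays, which is why each scalar variable of the program occupies cell 0 of
    an array of its own. *)
Definition frame (c : cmd) s s' : Prop :=
  (forall a, a \notin imods c -> imem s' a = imem s a) /\
  (forall a, a \notin rmods c -> rmem s' a = rmem s a).

Lemma frame_trans c s1 s2 s3 : frame c s1 s2 -> frame c s2 s3 -> frame c s1 s3.
Proof.
by case=> i1 r1 [i2 r2]; split=> a ha; [rewrite i2 ?i1 | rewrite r2 ?r1].
Qed.

Lemma frame_sub c c' s s' :
  {subset imods c <= imods c'} -> {subset rmods c <= rmods c'} ->
  frame c s s' -> frame c' s s'.
Proof.
move=> hi hr [i1 r1]; split=> a ha; first by apply: i1; apply: contra ha; exact: hi.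
by apply: r1; apply: contra ha; exact: hr.
Qed.

Lemma upd_neq (T : Type) (m : nat -> nat -> T) a i x b :
  b != a -> upd m a i x b = m b.
Proof. by move=> h; rewrite /upd (negbTE h). Qed.

Lemma exec_frame c s s' t : exec w c s s' t -> frame c s s'.
Proof.
elim=> {c s s' t} /=.
- by [].
- by move=> s a i e; split=> b //; rewrite mem_seq1 => h /=; rewrite upd_neq.
- by move=> s a i e; split=> b //; rewrite mem_seq1 => h /=; rewrite upd_neq.
- move=> s1 s2 s3 c1 c2 t1 t2 _ f1 _ f2.
  by apply: frame_trans (frame_sub _ _ f1) (frame_sub _ _ f2) => x h /=;
    rewrite mem_cat h ?orbT.
- move=> s s' b c1 c2 t _ _ f1.
  by apply: frame_sub f1 => x h /=; rewrite mem_cat h ?orbT.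
- move=> s s' b c1 c2 t _ _ f1.
  by apply: frame_sub f1 => x h /=; rewrite mem_cat h ?orbT.
- by [].
- move=> s1 s2 s3 b c t1 t2 _ _ f1 _ f2.
  exact: frame_trans f1 f2.
Qed.

Definition runs (c : cmd) s (T : nat) Q : Prop :=
  exists s' t, [/\ exec w c s s' t, (t <= T)%N & Q s'].

Lemma runs_weaken c s T T' Q Q' :
  runs c s T Q -> (T <= T')%N -> (forall s', Q s' -> Q' s') -> runs c s T' Q'.
Proof.
move=> [s' [t [h1 h2 h3]]] hT hQ; exists s', t; split=> //; last exact: hQ.
exact: leq_trans hT.
Qed.

Lemma runs_skip s T Q : (0 < T)%N -> Q s -> runs Skip s T Q.
Proof. by move=> hT hQ; exists s, 1%N; split=> //; exact: ExecSkip. Qed.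

Lemma runs_iset a i e s T Q :
  Q (State (upd (imem s) a (ieval w s i) (ieval w s e)) (rmem s)) ->
  (icost i + icost e < T)%N -> runs (ISet a i e) s T Q.
Proof.
move=> hQ hT; exists (State (upd (imem s) a (ieval w s i) (ieval w s e)) (rmem s)).
by exists (icost i + icost e).+1; split=> //; exact: ExecISet.
Qed.

Lemma runs_rset a i e s T Q :
  Q (State (imem s) (upd (rmem s) a (ieval w s i) (reval w s e))) ->
  (icost i + rcost e < T)%N -> runs (RSet a i e) s T Q.
Proof.
move=> hQ hT; exists (State (imem s) (upd (rmem s) a (ieval w s i) (reval w s e))).
by exists (icost i + rcost e).+1; split=> //; exact: ExecRSet.
Qed.

Lemma runs_seq c1 c2 s T1 T2 T Q :
  runs c1 s T1 (fun s1 => runs c2 s1 T2 Q) -> (T1 + T2 <= T)%N ->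
  runs (Seq c1 c2) s T Q.
Proof.
case=> s1 [t1 [e1 le1 [s2 [t2 [e2 le2 hQ]]]]] hT; exists s2, (t1 + t2)%N.
by split=> //; [exact: ExecSeq e1 e2 | apply: leq_trans hT; apply: leq_add].
Qed.

Lemma runs_if b c1 c2 s T1 T Q :
  (beval w s b -> runs c1 s T1 Q) -> (~~ beval w s b -> runs c2 s T1 Q) ->
  (bcost b + T1 < T)%N -> runs (If b c1 c2) s T Q.
Proof.
move=> h1 h2 hT; case: (boolP (beval w s b)) => hb.
- have [s' [t [e le hQ]]] := h1 hb; exists s', (bcost b + t).+1; split=> //.
    exact: ExecIfTrue.
  by apply: leq_trans hT; rewrite ltnS leq_add2l.
- have [s' [t [e le hQ]]] := h2 hb; exists s', (bcost b + t).+1; split=> //.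
    exact: ExecIfFalse.
  by apply: leq_trans hT; rewrite ltnS leq_add2l.
Qed.

Lemma runs_while_false b c s T Q :
  ~~ beval w s b -> Q s -> (bcost b < T)%N -> runs (While b c) s T Q.
Proof.
by move=> hb hQ hT; exists s, (bcost b).+1; split=> //; exact: ExecWhileFalse.
Qed.

Lemma runs_while_true b c s T1 T2 T Q :
  beval w s b -> runs c s T1 (fun s1 => runs (While b c) s1 T2 Q) ->
  (bcost b + T1 + T2 < T)%N -> runs (While b c) s T Q.
Proof.
move=> hb [s1 [t1 [e1 le1 [s2 [t2 [e2 le2 hQ]]]]]] hT.
exists s2, (bcost b + t1 + t2).+1; split=> //; first exact: ExecWhileTrue e1 e2.
by apply: leq_trans hT; rewrite ltnS leq_add // leq_add2l.
Qed.

Definition put (v k : nat) s : state R := State (upd (imem s) v 0%N k) (rmem s).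

(** The invariant speaks of states whose counter has already been advanced, hence the [put]. Since
    [e] is evaluated again in each round, it must have the value [m] in every state that the frame
    allows; [m < 2 ^ w] keeps the counter from wrapping. The extra round in the time bound covers
    the initialisation and the last test. *)
Lemma runs_for v e c s0 m T T' (I : nat -> state R -> Prop) Q :
  v \notin imods c -> (m < 2 ^ w)%N ->
  (forall s, frame (For v e c) s0 s -> ieval w s e = m) ->
  I 0%N (put v 0 s0) ->
  (forall k s, (k < m)%N -> frame (For v e c) s0 s -> imem s v 0 = k -> I k s ->
     runs c s T (fun s' => I k.+1 (put v k.+1 s'))) ->
  (m.+1 * (T + icost e + 12) <= T')%N ->
  (forall s, frame (For v e c) s0 s -> I m s -> Q s) ->
  runs (For v e c) s0 T' Q.
Proof.
move=> hv hm he I0 hc hT hQ.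
set F := For v e c.
have frame_put k s s' : frame c s s' -> frame F s0 s -> frame F s0 (put v k s').
  move=> f1 f2; have [hi hr] : frame F s0 s'.
    apply: frame_trans f2 (frame_sub _ _ f1) => x hx //=.
      by rewrite inE mem_cat hx orbT.
    by rewrite cats0.
  split=> a ha /=; last exact: hr.
  rewrite upd_neq; first exact: hi.
  by apply: contra ha => /eqP->; rewrite inE eqxx.
have h0 : (0 %% 2 ^ w)%N = 0%N by rewrite mod0n.
have loop d : forall k s, (k + d = m)%N -> frame F s0 s -> imem s v 0 = k -> I k s ->
    runs (While (blt (var v) e) (Seq c (setvar v (IAdd (var v) (ILit 1))))) s
      (d * (T + icost e + 12) + icost e + 6)%N Q.
  elim: d => [|d IH] k s hk fs vs Is.
    rewrite addn0 in hk; subst k.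
    apply: runs_while_false => /=.
    - by rewrite h0 he // hk leqnn.
    - by apply: hQ => //; rewrite -hk.
    - by lia.
  have hkm : (k < m)%N by lia.
  have h1 : (1 %% 2 ^ w)%N = 1%N by rewrite modn_small //; lia.
  apply: (@runs_while_true _ _ _ (T + 6) (d * (T + icost e + 12) + icost e + 6)).
  - by rewrite /= h0 he // vs -ltnNge.
  - have [s' [t [e1 le1 I1]]] := hc k s hkm fs vs Is.
    have f1 := exec_frame e1.
    have vs' : imem s' v 0 = k by rewrite f1.1.
    apply: (@runs_seq _ _ _ T 6) => //; exists s', t; split=> //.
    apply: runs_iset => //=.
    rewrite h0 h1 vs' modn_small; last by lia.
    rewrite addn1; apply: (IH k.+1) => //.
    - by lia.
    - exact: (frame_put _ s).
    - by rewrite /= /upd !eqxx.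
  - by rewrite /=; lia.
apply: (@runs_seq _ _ _ 4 (m * (T + icost e + 12) + icost e + 6)).
  apply: runs_iset => //=; rewrite !h0.
  apply: (loop m 0%N) => //.
  - exact: (frame_put 0%N s0).
  - by rewrite /= /upd !eqxx.
by rewrite mulSn in hT; lia.
Qed.

End Logic.

(** * Halving a list of rows *)

Section GreedyBalancing.
Variables (R : realType) (T : finType) (D : nat -> T -> R) (V : R).

(** Cauchy-Schwarz in linear form: |y| <= (y^2 / x + x) / 2 for each entry. Leaving [x] free avoids
    the square root of a sum and lets each use balance the two terms. *)
Lemma sum_norm_le_sqr (v : T -> R) (x : R) : 0 < x ->
  \sum_t `|v t| <= ((\sum_t v t ^+ 2) / x + #|T|%:R * x) / 2.
Proof.
move=> x0; rewrite mulr_suml -sum1_card natr_sum [X in _ + X]mulr_suml -big_split /= mulr_suml.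
apply: ler_sum => t _; rewrite mul1r -(real_normK (num_real (v t))).
set y := `|v t|.
have -> : (y ^+ 2 / x + x) / 2 = y + (y - x) ^+ 2 / (2 * x).
  by field; rewrite gt_eqF.
by rewrite lerDl divr_ge0 ?sqr_ge0 // mulr_ge0 // ltW.
Qed.

(** [i - i %% B] is the start of the block of [i]. The cross term of each new member with the sum of
    its block is nonpositive, so r members have squared norm at most r V. This is converted to the
    l^1 norm block by block, and the blocks, the last one possibly incomplete, are added by the
    triangle inequality. *)
Lemma greedy_block_norm (B m : nat) (x : R) : (0 < B)%N -> 0 < x ->
  (forall i, (i < m)%N ->
     \sum_t D i t * (\sum_(k < i %% B) D (i - i %% B + k)%N t) <= 0) ->
  (forall i, (i < m)%N -> \sum_t D i t ^+ 2 <= V) ->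
  \sum_t `|\sum_(i < m) D i t| <=
    (m%:R * V / x + (m %/ B).+1%:R * (#|T|%:R * x)) / 2.
Proof.
move=> B0 x0 hD hV.
have block b r : (r <= B)%N -> (b * B + r <= m)%N ->
    \sum_t `|\sum_(k < r) D (b * B + k)%N t| <= (r%:R * V / x + #|T|%:R * x) / 2.
  move=> hr hm; apply: le_trans (sum_norm_le_sqr _ x0) _.
  rewrite ler_pM2r ?invr_gt0 // lerD2r ler_pM2r ?invr_gt0 //.
  elim: r hr hm => [|r IH] hr hm.
    by rewrite mul0r big1 // => t _; rewrite big_ord0 expr0n.
  have -> : \sum_t (\sum_(k < r.+1) D (b * B + k)%N t) ^+ 2 =
      \sum_t (\sum_(k < r) D (b * B + k)%N t) ^+ 2
      + 2 * \sum_t D (b * B + r)%N t * (\sum_(k < r) D (b * B + k)%N t)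
      + \sum_t D (b * B + r)%N t ^+ 2.
    rewrite mulr_sumr -!big_split /=; apply: eq_bigr => t _.
    by rewrite big_ord_recr /=; ring.
  have h1 := IH (ltnW hr) (ltac:(lia)).
  have := hD (b * B + r)%N (ltac:(lia)); have h3 := hV (b * B + r)%N (ltac:(lia)).
  rewrite modnMDl modn_small // addnK => h2.
  by rewrite -natr1 mulrDl mul1r; lra.
have full b : (b * B <= m)%N -> \sum_t `|\sum_(i < b * B) D i t| <=
    b%:R * ((B%:R * V / x + #|T|%:R * x) / 2).
  elim: b => [|b IH] hb.
    by rewrite mul0r big1 // => t _; rewrite mul0n big_ord0 normr0.
  have h1 := IH (ltac:(lia)); have h2 := block b B (leqnn B) (ltac:(lia)).
  rewrite -natr1 mulrDl mul1r; apply: le_trans (lerD h1 h2).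
  rewrite -big_split /=; apply: ler_sum => t _.
  rewrite mulSn addnC big_split_ord /=; exact: ler_normD.
have h1 := full (m %/ B)%N (leq_trunc_div _ _).
have h2 := block (m %/ B)%N (m %% B)%N (ltnW (ltn_pmod _ B0))
  (ltac:(by rewrite -divn_eq)).
have hs : \sum_t `|\sum_(i < m) D i t| <= \sum_t `|\sum_(i < m %/ B * B) D i t|
    + \sum_t `|\sum_(k < m %% B) D (m %/ B * B + k)%N t|.
  rewrite -big_split /=; apply: ler_sum => t _.
  have -> : \sum_(i < m) D i t = \sum_(i < m %/ B * B + m %% B) D i t.
    by rewrite -divn_eq.
  by rewrite big_split_ord /=; exact: ler_normD.
apply: le_trans hs _; apply: le_trans (lerD h1 h2) _.
have {3}-> : m = (m %/ B * B + m %% B)%N by rewrite -divn_eq.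
by rewrite -natr1 natrD natrM le_eqVlt; apply/orP; left; apply/eqP; ring.
Qed.

End GreedyBalancing.

Section Halving.
Variables (R : realType) (a : nat -> nat -> R) (q : nat).
Hypothesis a01 : forall i j, 0 <= a i j <= 1.

Definition ip (x y : nat) : R := \sum_(j < q) a x j * a y j.

Definition outer (x : nat) (t : 'I_q * 'I_q) : R := a x t.1 * a x t.2.

Definition gram (L : nat -> nat) (m : nat) (t : 'I_q * 'I_q) : R :=
  \sum_(i < m) outer (L i) t.

Definition split_pairs (L : nat -> nat) (m : nat) (kp dr : nat -> nat) : Prop :=
  forall i, (i < m)%N ->
    (kp i = L i.*2 /\ dr i = L i.*2.+1) \/ (kp i = L i.*2.+1 /\ dr i = L i.*2).

(** This is the Hilbert-Schmidt inner product of x x^T with the sum of kept minus dropped over the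
    earlier pairs in the block of [i], so [balanced] says that the cross terms are nonpositive. *)
Definition score (B : nat) (kp dr : nat -> nat) (i x : nat) : R :=
  \sum_(k < i %% B) (ip x (kp (i - i %% B + k)%N) ^+ 2
                     - ip x (dr (i - i %% B + k)%N) ^+ 2).

Definition balanced (B m : nat) (kp dr : nat -> nat) : Prop :=
  forall i, (i < m)%N -> score B kp dr i (kp i) <= score B kp dr i (dr i).

(** An inner product of q x q matrices thus costs only O(q) steps. *)
Lemma outer_inner x y : \sum_t outer x t * outer y t = ip x y ^+ 2.
Proof.
rewrite expr2 /ip big_distrlr /= pair_big /=.
by apply: eq_bigr => -[j j'] _ /=; rewrite /outer /=; ring.
Qed.

Lemma ip_bounds x y : 0 <= ip x y <= q%:R.
Proof.
have h j : 0 <= a x j * a y j <= 1.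
  have /andP[h1 h2] := a01 x j; have /andP[h3 h4] := a01 y j.
  by rewrite mulr_ge0 // mulr_ile1.
apply/andP; split; first by apply: sumr_ge0 => j _; case/andP: (h j).
rewrite -[X in _ <= X%:R]card_ord -sum1_card natr_sum.
by apply: ler_sum => j _; case/andP: (h j).
Qed.

Lemma outer_norm x : \sum_t `|outer x t| <= q%:R ^+ 2.
Proof.
have <- : #|{: 'I_q * 'I_q}|%:R = q%:R ^+ 2 :> R.
  by rewrite card_prod card_ord natrM expr2.
rewrite -sum1_card natr_sum.
apply: ler_sum => t _; rewrite /outer.
have /andP[h1 h2] := a01 x t.1; have /andP[h3 h4] := a01 x t.2.
by rewrite ger0_norm ?mulr_ge0 // mulr_ile1.
Qed.

(** Kept plus dropped is twice kept minus the difference [D], so the error is the greedy sum, plus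
    one row of norm at most q^2 if [len] is odd. The best parameter is the root of the smaller of
    [B] and [len./2]; the sum of the two inverse roots covers both cases. *)
Lemma halving_error (L kp dr : nat -> nat) (len B : nat) :
  (0 < B)%N -> (1 < len)%N -> split_pairs L len./2 kp dr -> balanced B len./2 kp dr ->
  \sum_t `|gram L len t - 2 * gram kp len./2 t| <=
    3 / 2 * len%:R * q%:R ^+ 2
      * ((Num.sqrt B%:R)^-1 + (Num.sqrt (len./2)%:R)^-1).
Proof.
move=> B0 len1 hs hb; set nl := len./2.
have nl0 : (0 < nl)%N by rewrite /nl; lia.
pose D i t := outer (kp i) t - outer (dr i) t.
have err x : 0 < x -> \sum_t `|gram L len t - 2 * gram kp nl t| <=
    (nl%:R * (2 * q%:R ^+ 2) / x + (nl %/ B).+1%:R * (q%:R ^+ 2 * x)) / 2 + q%:R ^+ 2.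
  move=> x0.
  have := @greedy_block_norm R ('I_q * 'I_q)%type D (2 * q%:R ^+ 2) B nl x B0 x0.
  rewrite card_prod card_ord natrM -expr2 => hD.
  have {hD} hD : \sum_t `|\sum_(i < nl) D i t| <=
      (nl%:R * (2 * q%:R ^+ 2) / x + (nl %/ B).+1%:R * (q%:R ^+ 2 * x)) / 2.
    apply: hD => i hi.
      have -> : \sum_t D i t * (\sum_(k < i %% B) D (i - i %% B + k)%N t) =
          score B kp dr i (kp i) - score B kp dr i (dr i).
        rewrite /score -sumrB; under eq_bigr => t _ do rewrite mulr_sumr.
        rewrite exchange_big /=; apply: eq_bigr => k _; rewrite -!outer_inner.
        by rewrite -!sumrB; apply: eq_bigr => t _; rewrite /D; ring.
      by rewrite subr_le0; exact: hb.
    have -> : \sum_t D i t ^+ 2 =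
        ip (kp i) (kp i) ^+ 2 - 2 * ip (kp i) (dr i) ^+ 2 + ip (dr i) (dr i) ^+ 2.
      rewrite -!outer_inner mulr_sumr -sumrB -big_split /=.
      by apply: eq_bigr => t _; rewrite /D; ring.
    have sq u v : ip u v ^+ 2 <= q%:R ^+ 2.
      by have /andP[h1 h2] := ip_bounds u v; rewrite lerXn2r ?nnegrE.
    have h1 := sq (kp i) (kp i); have h2 := sq (dr i) (dr i).
    by have h3 := sqr_ge0 (ip (kp i) (dr i)); lra.
  have pairs t : gram L len t - 2 * gram kp nl t =
      (if odd len then outer (L len.-1) t else 0) - \sum_(i < nl) D i t.
    have even m : (m <= nl)%N -> gram L m.*2 t =
        2 * gram kp m t - \sum_(i < m) D i t.
      elim: m => [|m IH] hm; first by rewrite /gram !big_ord0; ring.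
      move: (IH (ltnW hm)) (hs m hm); rewrite /gram doubleS !big_ord_recr /= => ->.
      by case=> -[hk hd]; rewrite /D hk hd; ring.
    have {1 3}-> : len = (odd len + nl.*2)%N by rewrite odd_double_half.
    case: (odd len); rewrite ?add0n ?add1n; last by rewrite even //; ring.
    by rewrite {1}/gram big_ord_recr /= -/(gram _ _ _) even //; ring.
  rewrite addrC.
  apply: (@le_trans _ _ (\sum_t `|if odd len then outer (L len.-1) t else 0|
      + \sum_t `|\sum_(i < nl) D i t|)).
    by rewrite -big_split /=; apply: ler_sum => t _; rewrite pairs; exact: ler_normB.
  apply: lerD => //; case: (odd len); first exact: outer_norm.
  by rewrite big1 ?sqr_ge0 // => t _; rewrite normr0.
(* The norms within blocks, the number of blocks and the unpaired row contribute at most nl / x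
   each, in units of q^2; this gives the factor 3, and nl <= len / 2 turns it into 3 / 2. *)
have bound (x : R) : 1 <= x -> x ^+ 2 <= B%:R -> x ^+ 2 <= nl%:R ->
    \sum_t `|gram L len t - 2 * gram kp nl t| <= 3 / 2 * len%:R * q%:R ^+ 2 * x^-1.
  move=> x1 xB xn; have x0 : 0 < x by lra.
  apply: le_trans (err x x0) _.
  have h1 : (nl %/ B)%:R * x <= nl%:R * x^-1.
    rewrite ler_pdivlMr // -mulrA -expr2.
    apply: le_trans (_ : (nl %/ B)%:R * B%:R <= _); first by rewrite ler_wpM2l.
    by rewrite -natrM ler_nat leq_trunc_div.
  have h2 : x <= nl%:R * x^-1 by rewrite ler_pdivlMr // -expr2.
  have h3 : 1 <= nl%:R * x^-1 by lra.
  have h4 : nl%:R * x^-1 * 2 <= len%:R * x^-1.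
    rewrite mulrAC ler_wpM2r ?invr_ge0 ?(ltW x0) // -natrM ler_nat /nl; lia.
  have q0 : 0 <= q%:R ^+ 2 :> R by exact: sqr_ge0.
  rewrite -[(nl %/ B).+1%:R]natr1; set y := nl%:R * x^-1 in h1 h2 h3 h4 *.
  set z := len%:R * x^-1 in h4; set Q := q%:R ^+ 2 in q0 *.
  have -> : 3 / 2 * len%:R * Q * x^-1 = 3 / 2 * z * Q by rewrite /z; ring.
  have -> : (nl%:R * (2 * Q) / x + ((nl %/ B)%:R + 1) * (Q * x)) / 2 + Q =
     (y + ((nl %/ B)%:R * x + x) / 2 + 1) * Q by rewrite /y; field; rewrite gt_eqF.
  by apply: ler_wpM2r => //; lra.
have B1 : 1 <= B%:R :> R by rewrite ler1n.
have n1 : 1 <= nl%:R :> R by rewrite ler1n.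
have s1 (y : R) : 1 <= y -> 1 <= Num.sqrt y.
  by move=> h; rewrite -sqrtr1 ler_wsqrtr.
have c0 : 0 <= 3 / 2 * len%:R * q%:R ^+ 2 :> R.
  by rewrite mulr_ge0 ?sqr_ge0 // mulr_ge0 ?ler0n //; lra.
have i0 (y : R) : 0 <= (Num.sqrt y)^-1 by rewrite invr_ge0 sqrtr_ge0.
case: (leqP B nl) => hB.
- apply: le_trans (bound (Num.sqrt B%:R) _ _ _) _; rewrite ?sqr_sqrtr ?s1 ?ler_nat //.
  by apply: ler_wpM2l => //; rewrite lerDl.
- apply: le_trans (bound (Num.sqrt nl%:R) _ _ _) _;
    rewrite ?sqr_sqrtr ?s1 ?ler_nat // 1?ltnW //.
  by apply: ler_wpM2l => //; rewrite lerDr.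
Qed.

End Halving.

(** * The accumulated error of all halvings *)

Section Potential.
Variable R : realType.

Lemma inv_sqrt_le (k x y : R) : 0 < k -> 0 < x -> k ^+ 2 * x <= y ->
  k * (Num.sqrt y)^-1 <= (Num.sqrt x)^-1.
Proof.
move=> k0 x0 hxy; have y0 : 0 < y by apply: lt_le_trans hxy; rewrite mulr_gt0 ?exprn_gt0.
rewrite ler_pdivrMr ?sqrtr_gt0 // mulrC ler_pdivlMr ?sqrtr_gt0 //.
by rewrite -[X in X * _](ger0_norm (ltW k0)) -sqrtr_sqr -sqrtrM ?sqr_ge0 // ler_wsqrtr.
Qed.

(* Bounds the error, in units of q^2, of all halvings that start from a list of
   [len] rows with blocks of [B] pairs and stop at length at most [K]. *)
Definition halving_potential (K len B : nat) : R :=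
  if (len <= K)%N then 0 else
  len%:R * (12 * (Num.sqrt B%:R)^-1
            + 6 * (2 * (Num.sqrt K%:R)^-1 - (Num.sqrt len%:R)^-1)).

(** The coefficients solve the recursion. With 1 / sqrt B shrinking by 7 / 8, 3/2 + 12 (7/8) = 12.
    The negative term grows in absolute value by at least 7 / 5 when the length is halved, and (6 -
    3/2) (7/5) >= 6 pays for the new 1 / sqrt (len./2). The factor 2 is the doubled weight of the
    surviving rows and cancels against their halved number. *)
Lemma halving_potential_step (K len B : nat) :
  (0 < K)%N -> (1 < B)%N -> (K < len)%N ->
  3 / 2 * len%:R * ((Num.sqrt B%:R)^-1 + (Num.sqrt (len./2)%:R)^-1)
    + 2 * halving_potential K len./2 (B + B %/ 2) <= halving_potential K len B.
Proof.
move=> K0 B1 hK; rewrite /halving_potential (leqNgt len) hK /=.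
have len0 : 0 <= len%:R :> R by [].
have pos (m : nat) : (0 < m)%N -> 0 < m%:R :> R by rewrite ltr0n.
set b := (Num.sqrt B%:R)^-1; set k := (Num.sqrt K%:R)^-1.
set h := (Num.sqrt (len./2)%:R)^-1; set l := (Num.sqrt len%:R)^-1.
have b0 : 0 <= b by rewrite invr_ge0 sqrtr_ge0.
have h0 : 0 <= h by rewrite invr_ge0 sqrtr_ge0.
have k0 : 0 <= k by rewrite invr_ge0 sqrtr_ge0.
have lk : 1 * l <= k.
  by apply: inv_sqrt_le; rewrite ?pos // expr1n mul1r ler_nat ltnW.
have [hle|hgt] := leqP len./2 K.
  have hk : 2 / 3 * h <= k.
    apply: inv_sqrt_le; rewrite ?pos //; first by lra.
    have : K%:R <= (2 * len./2)%:R :> R by rewrite ler_nat; lia.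
    by rewrite natrM => h1; have := pos K K0; lra.
  rewrite mulr0 addr0 [3 / 2 * _]mulrC -mulrA; apply: ler_wpM2l => //; lra.
have hk : 1 * h <= k.
  by apply: inv_sqrt_le; rewrite ?pos // expr1n mul1r ler_nat ltnW.
have lh : 7 / 5 * l <= h.
  apply: inv_sqrt_le; rewrite ?pos //; [by lra | by lia | ].
  have : (2 * len./2)%:R <= len%:R :> R by rewrite ler_nat; lia.
  by rewrite natrM => h1; have : 0 <= (len./2)%:R :> R by []; lra.
set b' := (Num.sqrt (B + _)%:R)^-1.
have b'0 : 0 <= b' by rewrite invr_ge0 sqrtr_ge0.
(* Despite the rounding, B + B %/ 2 >= 4 B / 3 as soon as B >= 2, and (8 / 7)^2 < 4 / 3. *)
have bb : 8 / 7 * b' <= b.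
  apply: inv_sqrt_le; rewrite ?pos //; [by lra | by lia | ].
  have : (4 * B)%:R <= (3 * (B + B %/ 2))%:R :> R by rewrite ler_nat; lia.
  by rewrite !natrM => h1; have : 0 <= B%:R :> R by []; lra.
have h2 : 2 * (len./2)%:R <= len%:R :> R by rewrite -natrM ler_nat; lia.
rewrite mulrA; apply: le_trans (lerD (lexx _) (ler_wpM2r _ h2)) _; first by lra.
rewrite [3 / 2 * _]mulrC -mulrA -mulrDr; apply: ler_wpM2l => //; lra.
Qed.

(** At K = B = m^2 both parts of the potential contribute 12 / m. *)
Lemma halving_potential_init (m len : nat) : (0 < m)%N ->
  halving_potential (m ^ 2) len (m ^ 2) <= len%:R * 24 / m%:R.
Proof.
move=> m0; rewrite /halving_potential natrX sqrtr_sqr ger0_norm //.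
have m1 : 0 <= m%:R^-1 :> R by rewrite invr_ge0.
case: ifP => _; first by rewrite !mulr_ge0.
rewrite -mulrA; apply: ler_wpM2l => //.
have : 0 <= (Num.sqrt len%:R)^-1 :> R by rewrite invr_ge0 sqrtr_ge0.
by lra.
Qed.

End Potential.

(** * Unions of cells and the extremal U *)

Section Rank.
Variables (T : finType) (A : {set T}) (key : T -> nat).
Hypothesis key_inj : {in A &, injective key}.

Definition rank (i : T) : nat := #|[set i' in A | (key i' < key i)%N]|.

Lemma rank_lt i : i \in A -> (rank i < #|A|)%N.
Proof.
move=> iA; apply: proper_card; apply/properP; split.
  by apply/subsetP => x; rewrite inE => /andP[].
by exists i => //; rewrite inE ltnn andbF.
Qed.

Lemma rank_mono i i' : i \in A -> (key i < key i')%N -> (rank i < rank i')%N.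
Proof.
move=> iA h; apply: proper_card; apply/properP; split.
  by apply/subsetP => x; rewrite !inE => /andP[-> /= hx]; exact: ltn_trans h.
by exists i; rewrite inE ?iA ?h // ltnn andbF.
Qed.

Lemma rank_inj : {in A &, injective rank}.
Proof.
move=> i i' iA iA' h; apply: key_inj => //.
case: (ltngtP (key i) (key i')) => // hlt.
- by have := rank_mono iA hlt; rewrite h ltnn.
- by have := rank_mono iA' hlt; rewrite h ltnn.
Qed.

(** Ranks inject [A] into the numbers below its size, so every such number is a rank exactly
    once. *)
Lemma card_rank_lt (m : nat) : (m <= #|A|)%N ->
  #|[set i in A | (rank i < m)%N]| = m.
Proof.
move=> hm.
have u : uniq (map rank (enum A)).
  rewrite map_inj_in_uniq ?enum_uniq // => i i'; rewrite !mem_enum; exact: rank_inj.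
have sub : {subset map rank (enum A) <= iota 0 #|A|}.
  move=> x /mapP[i]; rewrite mem_enum => iA ->.
  by rewrite mem_iota add0n rank_lt.
have [_ eqm] := uniq_min_size u sub (ltac:(by rewrite size_map size_iota -cardE)).
have pe : perm_eq (map rank (enum A)) (iota 0 #|A|).
  by apply: uniq_perm => //; exact: iota_uniq.
have cnt : count (fun x => (x < m)%N) (iota 0 #|A|) = m.
  rewrite -{1}(subnKC hm) iotaD count_cat add0n.
  rewrite (eq_in_count (a2 := predT)); last by move=> x; rewrite mem_iota.
  rewrite (eq_in_count (s := iota m _) (a2 := pred0)); last first.
    by move=> x; rewrite mem_iota => /andP[h _]; rewrite ltnNge h.
  by rewrite count_predT size_iota count_pred0 addn0.
rewrite -[RHS]cnt -(permP pe) count_map -sum1_card -sum1_count big_enum_cond /=.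
by apply: eq_bigl => i; rewrite inE.
Qed.

End Rank.

(** * Rounding a set of columns to cells *)

Section AtomNet.
Variables (R : realType) (q : nat) (code : nat -> nat).

Definition atom_rank (j : nat) : nat := (\sum_(j' < j) (code j' == code j))%N.

(** The sampled rows are constant on an atom, so only the number of chosen elements in each atom
    matters. Initial runs of [f b] cells in atom [b] therefore suffice. *)
Definition cells_below (g : nat) (f : nat -> nat) : {set 'I_q} :=
  [set j : 'I_q | (atom_rank j %/ g < f (code j))%N].

Lemma card_atom_rank_lt (b m : nat) :
  (m <= #|[set j : 'I_q | code j == b]|)%N ->
  #|[set j : 'I_q | (code j == b) && (atom_rank j < m)%N]| = m.
Proof.
move=> hm; rewrite -[RHS](@card_rank_lt _ [set j : 'I_q | code j == b] val) //; last first.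
  by move=> x y _ _; exact: val_inj.
apply: eq_card => j; rewrite !inE; case: eqP => //= hj.
congr (_ < _)%N; rewrite /atom_rank /rank hj -sum1_card.
rewrite (big_ord_widen _ (fun k => (code k == b) : nat) (ltnW (ltn_ord j))).
rewrite big_mkcond [RHS]big_mkcond /=; apply: eq_bigr => i _.
by rewrite !inE; case: eqP; case: (i < j)%N.
Qed.

(* [v] is the indicator of [Ws] scaled down on each atom to the weight of the
   union of cells, so that the difference of the two sums to 0 on every atom. *)
Lemma cells_below_approx (g : nat) (Ws : {set 'I_q}) : (0 < g)%N ->
  exists f : nat -> nat, exists v : 'I_q -> R,
  [/\ forall j, 0 <= v j <= (j \in Ws)%:R,
      forall b, \sum_(j < q | code j == b) ((j \in cells_below g f)%:R - v j) = 0 &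
      forall b, \sum_(j < q | code j == b) ((j \in Ws)%:R - v j) <= g.-1%:R].
Proof.
move=> g0.
pose c b := #|[set j in Ws | code j == b]|.
pose f b := (c b %/ g)%N.
(* For an atom disjoint from [Ws] the quotient is 0, by the convention for division by 0. *)
have ratio b : 0 <= ((f b * g)%:R / (c b)%:R : R) <= 1.
  rewrite divr_ge0 //=; case: (posnP (c b)) => [->|cb].
    by rewrite invr0 mulr0.
  by rewrite ler_pdivrMr ?ltr0n // mul1r ler_nat leq_trunc_div.
have scaled b : \sum_(j < q | code j == b)
    (j \in Ws)%:R * ((f (code j) * g)%:R / (c (code j))%:R) = (f b * g)%:R :> R.
  under eq_bigr => j /eqP hj do rewrite hj.
  rewrite -mulr_suml.
  have -> : \sum_(j < q | code j == b) (j \in Ws)%:R = (c b)%:R :> R.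
    rewrite -natr_sum /c -sum1_card; congr (_%:R).
    rewrite big_mkcond [RHS]big_mkcond /=; apply: eq_bigr => j _.
    by rewrite inE; case: (j \in Ws); case: eqP.
  case: (posnP (c b)) => [h|cb]; first by rewrite /f h div0n mul0r.
  by rewrite mulrC divfK // pnatr_eq0 -lt0n.
exists f, (fun j => (j \in Ws)%:R * ((f (code j) * g)%:R / (c (code j))%:R)).
split.
- move=> j; have /andP[r0 r1] := ratio (code j).
  by rewrite mulr_ge0 //= ler_piMr.
- move=> b; rewrite sumrB scaled.
  rewrite -natr_sum; apply/eqP; rewrite subr_eq0 eqr_nat; apply/eqP.
  (* Rounding down makes [f b * g] at most [c b], hence at most the size of the atom, so all
     selected cells are full. *)
  rewrite -[RHS](@card_atom_rank_lt b); last first.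
    apply: leq_trans (leq_trunc_div _ _) _; apply: subset_leq_card.
    by apply/subsetP => j; rewrite !inE => /andP[].
  rewrite -sum1_card big_mkcond [RHS]big_mkcond /=; apply: eq_bigr => j _.
  by rewrite !inE; case: eqP => //= ->; rewrite ltn_divLR.
- move=> b; rewrite sumrB scaled -natr_sum.
  have -> : (\sum_(j < q | code j == b) (j \in Ws))%N = c b.
    rewrite /c -sum1_card big_mkcond [RHS]big_mkcond /=; apply: eq_bigr => j _.
    by rewrite inE; case: (j \in Ws); case: eqP.
  rewrite {1}(divn_eq (c b) g) natrD [_%:R + _]addrC addrK ler_nat.
  by have := ltn_pmod (c b) g0; lia.
Qed.

End AtomNet.

(** * From Gram matrices to edge counts *)

Section Approximation.
Variables (R : realType) (a : nat -> nat -> R) (p q : nat).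
Hypothesis a01 : forall i j, 0 <= a i j <= 1.

Lemma sum_sqr_gram (L : nat -> nat) (m : nat) (u : 'I_q -> R) :
  \sum_(i < m) (\sum_(j < q) a (L i) j * u j) ^+ 2 =
  \sum_t u t.1 * u t.2 * gram a (q := q) L m t.
Proof.
transitivity (\sum_(i < m) \sum_t u t.1 * u t.2 * outer a (q := q) (L i) t).
  apply: eq_bigr => i _; rewrite expr2 big_distrlr /= pair_big /=.
  by apply: eq_bigr => -[j j'] _; rewrite /outer /=; ring.
by rewrite exchange_big; apply: eq_bigr => t _; rewrite /gram mulr_sumr.
Qed.

(** Both sums of squares are quadratic forms of Gram matrices at [u]. The form of the sample
    vanishes by orthogonality, whatever its weight [om], and the products of entries of [u] are at
    most 1, so the l^1 distance of the matrices bounds what remains. *)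
Lemma orthogonal_sum_sqr (L : nat -> nat) (len : nat) (om E : R) (u : 'I_q -> R) :
  (forall j, `|u j| <= 1) ->
  (forall s, (s < len)%N -> \sum_(j < q) a (L s) j * u j = 0) ->
  \sum_t `|gram a (q := q) id p t - om * gram a L len t| <= E ->
  \sum_(i < p) (\sum_(j < q) a i j * u j) ^+ 2 <= E.
Proof.
move=> u1 ort; apply: le_trans.
have z : \sum_t u t.1 * u t.2 * gram a (q := q) L len t = 0.
  by rewrite -sum_sqr_gram big1 // => s _; rewrite ort // expr0n.
have -> : \sum_(i < p) (\sum_(j < q) a i j * u j) ^+ 2 =
    \sum_t (u t.1 * u t.2 * gram a id p t - om * (u t.1 * u t.2 * gram a L len t)).
  by rewrite sumrB -mulr_sumr z mulr0 subr0 (sum_sqr_gram id).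
apply: ler_sum => t _; set x := gram a id p t; set y := gram a L len t.
have -> : u t.1 * u t.2 * x - om * (u t.1 * u t.2 * y) =
    u t.1 * u t.2 * (x - om * y) by ring.
apply: le_trans (ler_norm _) _; rewrite normrM ler_piMl // normrM mulr_ile1 //.
Qed.

Variables (code : nat -> nat) (PK : nat).
Hypothesis code_lt : forall j, (j < q)%N -> (code j < PK)%N.

Lemma sum_atoms (F : 'I_q -> R) :
  \sum_j F j = \sum_(b < PK) \sum_(j < q | code j == b) F j.
Proof.
by rewrite (partition_big (fun j : 'I_q => Ordinal (code_lt (ltn_ord j))) predT).
Qed.

(** The indicators of [W] and [Ws] differ by u - z, where u sums to 0 on every atom and is thus
    orthogonal to the sample, and z >= 0 is the rounding loss, of total at most q / (4 N). Hence
    |Ws| - |W| is the sum of z, and u and z each change an edge count by at most pq / (4 N). *)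
Lemma cells_approximate (N len : nat) (L : nat -> nat) (om : R) (Ws : {set 'I_q}) :
  (0 < q)%N -> (0 < N)%N ->
  (forall s (j j' : 'I_q), (s < len)%N -> code j = code j' -> a (L s) j = a (L s) j') ->
  \sum_t `|gram a (q := q) id p t - om * gram a L len t| <=
    p%:R * q%:R ^+ 2 / (16 * N%:R ^+ 2) ->
  exists f : nat -> nat, let W := cells_below q code (q %/ (PK * 4 * N)).+1 f in
  [/\ #|W|%:R <= #|Ws|%:R :> R, #|Ws|%:R <= #|W|%:R + q%:R / (4 * N%:R) :> R &
      forall U : {set 'I_p}, `|\sum_(i in U) \sum_(j in W) a i j
        - \sum_(i in U) \sum_(j in Ws) a i j| <= p%:R * q%:R / (2 * N%:R)].
Proof.
move=> q0 N0 sep hE; set g := (q %/ (PK * 4 * N)).+1.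
have [f [v [v01 vW vWs]]] := @cells_below_approx R q code g Ws (ltn0Sn _).
exists f; set W := cells_below _ _ _ _ => /=.
have qR : 0 < q%:R :> R by rewrite ltr0n.
have NR : 0 < N%:R :> R by rewrite ltr0n.
have cardE (S : {set 'I_q}) : #|S|%:R = \sum_(j < q) (j \in S)%:R :> R.
  rewrite -sum1_card natr_sum big_mkcond /=.
  by apply: eq_bigr => j _; case: (j \in S).
pose u j : R := (j \in W)%:R - v j.
pose z j : R := (j \in Ws)%:R - v j.
have u1 j : `|u j| <= 1.
  have /andP[h1 h2] := v01 j; have h3 : (j \in Ws)%:R <= 1 :> R by case: (j \in Ws).
  by rewrite /u ler_norml; case: (j \in W); apply/andP; split; rewrite ?mulr1n ?mulr0n; lra.
have z0 j : 0 <= z j by have /andP[h1 h2] := v01 j; rewrite /z subr_ge0.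
have sum_u : \sum_j u j = 0 by rewrite sum_atoms big1 // => b _; exact: vW.
have sum_z : \sum_j z j <= q%:R / (4 * N%:R).
  rewrite sum_atoms.
  apply: (@le_trans _ _ (\sum_(b < PK) g.-1%:R)); first by apply: ler_sum => b _; exact: vWs.
  rewrite sumr_const card_ord -mulrnA ler_pdivlMr ?mulr_gt0 //.
  by rewrite -!natrM ler_nat /g /= -mulnA (mulnA PK) leq_trunc_div.
have ort s : (s < len)%N -> \sum_(j < q) a (L s) j * u j = 0.
  move=> hs; rewrite sum_atoms big1 // => b _.
  case: (pickP (fun j : 'I_q => code j == b)) => [j0 /eqP hj0|none]; last first.
    by rewrite big_pred0.
  transitivity (a (L s) j0 * \sum_(j < q | code j == b) u j); last first.
    by rewrite [X in _ * X]vW mulr0.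
  by rewrite mulr_sumr; apply: eq_bigr => j /eqP hj; rewrite (sep s j j0) // hj hj0.
have sq := orthogonal_sum_sqr u1 ort hE.
have norm_u : \sum_(i < p) `|\sum_(j < q) a i j * u j| <= p%:R * q%:R / (4 * N%:R).
  (* The value q / (4 N) balances the two terms of [sum_norm_le_sqr]: with the error p q^2 / (16
     N^2), each equals pq / (4 N). *)
  have x0 : 0 < q%:R / (4 * N%:R) :> R by rewrite divr_gt0 ?mulr_gt0.
  apply: le_trans (sum_norm_le_sqr _ x0) _.
  rewrite card_ord ler_pdivrMr //.
  apply: le_trans (lerD (_ : _ <= p%:R * q%:R / (4 * N%:R)) (lexx _)) _.
    rewrite ler_pdivrMr //; apply: le_trans sq _.
    rewrite le_eqVlt; apply/orP; left; apply/eqP; field; rewrite gt_eqF //.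
  rewrite le_eqVlt; apply/orP; left; apply/eqP; field; rewrite gt_eqF //.
have dWs : #|Ws|%:R - #|W|%:R = \sum_j z j.
  transitivity (\sum_j (z j - u j)); last by rewrite sumrB sum_u subr0.
  by rewrite !cardE -sumrB; apply: eq_bigr => j _; rewrite /z /u; ring.
split.
- by rewrite -subr_ge0 dWs; apply: sumr_ge0 => j _.
- by rewrite addrC -lerBlDr dWs.
move=> U.
have row (S : {set 'I_q}) i : \sum_(j in S) a i j = \sum_(j < q) a i j * (j \in S)%:R.
  rewrite big_mkcond /=; apply: eq_bigr => j _.
  by case: (j \in S); rewrite ?mulr1 ?mulr0.
have diff i : \sum_(j in W) a i j - \sum_(j in Ws) a i j =
    \sum_(j < q) a i j * u j - \sum_(j < q) a i j * z j.
  by rewrite !row -!sumrB; apply: eq_bigr => j _; rewrite /u /z; ring.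
have az (i : nat) : `|\sum_(j < q) a i j * z j| <= q%:R / (4 * N%:R).
  rewrite ger0_norm; last by apply: sumr_ge0 => j _; rewrite mulr_ge0 //; case/andP: (a01 i j).
  apply: le_trans sum_z; apply: ler_sum => j _.
  by rewrite ler_piMl //; case/andP: (a01 i j).
rewrite -sumrB; apply: le_trans (ler_norm_sum _ _ _) _.
apply: (@le_trans _ _ (\sum_(i < p) (`|\sum_(j < q) a i j * u j| + q%:R / (4 * N%:R)))).
  rewrite big_mkcond /=; apply: ler_sum => i _; case: ifP => _; last first.
    by rewrite addr_ge0 // divr_ge0 // mulr_ge0.
  rewrite diff; apply: le_trans (ler_normB _ _) _.
  by rewrite lerD2l.
rewrite big_split /= sumr_const card_ord -mulr_natl.
apply: le_trans (lerD norm_u (lexx _)) _.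
by rewrite le_eqVlt; apply/orP; left; apply/eqP; field; rewrite gt_eqF.
Qed.

End Approximation.

(** * Extremal sets of rows *)

Section Selection.
Variables (R : realType) (p : nat) (key : 'I_p -> nat) (x : R).
Hypothesis key_inj : injective key.

(** Comparing ranks with the real number [x] selects the least sufficient number of elements without
    computing a ceiling; the clause for rank 0 keeps the set nonempty when [x <= 0]. *)
Definition lowest : {set 'I_p} :=
  [set i | (rank [set: 'I_p] key i == 0%N) || ((rank [set: 'I_p] key i)%:R < x)].

(** Averages are compared with denominators cleared. Let [tau] be the largest value on [lowest]:
    summing [tau - h] over [lowest] collects exactly nonnegative terms and omits only nonpositive
    ones, so no set gives more, and [Us] is at least as large. *)
Lemma lowest_average (h : 'I_p -> R) (Us : {set 'I_p}) :
  (forall i i', (key i < key i')%N -> h i <= h i') ->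
  Us != set0 -> x <= #|Us|%:R ->
  [/\ (0 < #|lowest|)%N, x <= #|lowest|%:R &
      #|Us|%:R * \sum_(i in lowest) h i <= #|lowest|%:R * \sum_(i in Us) h i].
Proof.
move=> mono Us0 xU.
have inj : {in [set: 'I_p] &, injective key} by move=> i i' _ _; exact: key_inj.
have ex : exists s, (0 < s)%N && (x <= s%:R) by exists #|Us|; rewrite card_gt0 Us0.
case: (ex_minnP ex) => s /andP[s0 xs] smin.
have sU : (s <= #|Us|)%N by apply: smin; rewrite card_gt0 Us0.
have lowE : lowest = [set i in [set: 'I_p] | (rank [set: 'I_p] key i < s)%N].
  apply/setP => i; rewrite !inE /=; set r := rank _ _ _.
  apply/idP/idP => [/orP[/eqP->//|hr]|hr].
    by rewrite -(ltr_nat R); apply: lt_le_trans xs.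
  case: (posnP r) => [->//|r0] /=.
  by rewrite ltNge; apply/negP => hx; have := smin r; rewrite r0 hx leqNgt hr => /(_ isT).
have cardL : #|lowest| = s.
  rewrite lowE card_rank_lt //; apply: leq_trans sU _; exact/subset_leq_card/subsetT.
have [i1 hi1] : exists i, i \in lowest.
  by apply/set0Pn; rewrite -card_gt0 cardL.
split; rewrite ?cardL //.
have [i0 i0L kmax] := @arg_maxnP _ i1 (mem lowest) key hi1.
pose tau := h i0.
have hin i : i \in lowest -> h i <= tau.
  move=> /kmax; rewrite /= leq_eqVlt => /orP[/eqP/key_inj->//|]; exact: mono.
have hout i : i \notin lowest -> tau <= h i.
  move=> hi; apply: mono; rewrite ltnNge; apply/negP => hk.
  move: i0L hi; rewrite /= lowE !inE /= => i0L; rewrite -leqNgt => hi.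
  case: (ltngtP (key i) (key i0)) hk => // [hlt _|/key_inj e _].
    by have := rank_mono (A := setT) (in_setT i) hlt; lia.
  by rewrite e in hi; lia.
have pos i : 0 <= (if i \in lowest then tau - h i else 0).
  by case: ifP => // hi; rewrite subr_ge0 hin.
have le1 : \sum_(i in Us) (tau - h i) <= \sum_(i in lowest) (tau - h i).
  rewrite big_mkcond [X in _ <= X]big_mkcond; apply: ler_sum => i _.
  case: ifP => // _; case: ifP => // /negbT hi; by rewrite subr_le0 hout.
have ge0 : 0 <= \sum_(i in lowest) (tau - h i).
  by apply: sumr_ge0 => i hi; rewrite subr_ge0 hin.
have : s%:R * \sum_(i in Us) (tau - h i) <= #|Us|%:R * \sum_(i in lowest) (tau - h i).
  apply: le_trans (_ : s%:R * \sum_(i in lowest) (tau - h i) <= _).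
    by rewrite ler_wpM2l.
  by rewrite ler_wpM2r // ler_nat.
have sumd (S : {set 'I_p}) :
    \sum_(i in S) (tau - h i) = #|S|%:R * tau - \sum_(i in S) h i.
  by rewrite sumrB sumr_const mulr_natl.
rewrite !sumd cardL !mulrBr => hh.
have : s%:R * (#|Us|%:R * tau) = #|Us|%:R * (s%:R * tau) by ring.
by move=> e; rewrite e in hh; lra.
Qed.

End Selection.

(** * Irregularity survives the approximation *)

Section Witness.
Variables (R : realType) (p q : nat) (G : 'I_p -> 'I_q -> bool).
Implicit Types (U : {set 'I_p}) (W : {set 'I_q}).

Lemma edge_countE U W :
  (edge_count G U W)%:R = \sum_(i in U) \sum_(j in W) (G i j)%:R :> R.
Proof.
rewrite pair_big_dep /= /edge_count -sum1_card natr_sum big_mkcond [RHS]big_mkcond /=.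
apply: eq_bigr => -[i j] _ /=; rewrite inE /=.
by case: (i \in U); case: (j \in W); case: (G i j).
Qed.

Lemma edge_count_le U W : (edge_count G U W <= #|U| * #|W|)%N.
Proof.
rewrite -cardsX; apply: subset_leq_card; apply/subsetP => -[i j].
by rewrite !inE /= => /and3P[-> ->].
Qed.

Lemma density_bounds U W : 0 <= density R G U W <= 1.
Proof.
rewrite /density divr_ge0 ?mulr_ge0 //= -natrM.
case: (posnP (#|U| * #|W|)) => [->|h]; first by rewrite invr0 mulr0.
by rewrite ler_pdivrMr ?ltr0n // mul1r ler_nat edge_count_le.
Qed.

Lemma density_full_empty : (p == 0)%N || (q == 0)%N -> forall U W, density R G U W = 0.
Proof.
move=> h U W; rewrite /density -natrM; suff -> : (#|U| * #|W| = 0)%N by rewrite invr0 mulr0.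
have hU : (#|U| <= p)%N by rewrite -[X in (_ <= X)%N]card_ord max_card.
have hW : (#|W| <= q)%N by rewrite -[X in (_ <= X)%N]card_ord max_card.
have [a0|b0] : #|U| = 0%N \/ #|W| = 0%N by case/orP: h => /eqP; lia.
  by rewrite a0.
by rewrite b0 muln0.
Qed.

Definition degree W (i : 'I_p) : nat := (\sum_(j in W) G i j)%N.

(** The sign of the deviation decides between rows of low and of high degree into [W]. Shrinking
    [Us] to an extremal set of the least admissible size only enlarges the deviation, so [Us] itself
    need not be known. The losses are pq / (2 N) from the edge count and, for a negative deviation,
    pq / (4 N) from |Ws| - |W|. *)
Lemma irregular_found (eps al : R) (N : nat) (Us : {set 'I_p}) (Ws W : {set 'I_q}) :
  0 < eps -> 0 < al -> al <= 1 / 2 -> 1 <= N%:R * (eps * eps * eps * al) ->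
  eps * p%:R <= #|Us|%:R -> eps * q%:R <= #|Ws|%:R ->
  eps <= `|density R G Us Ws - density R G [set: _] [set: _]| ->
  #|W|%:R <= #|Ws|%:R :> R -> #|Ws|%:R <= #|W|%:R + q%:R / (4 * N%:R) :> R ->
  `|\sum_(i in Us) \sum_(j in W) (G i j)%:R
     - \sum_(i in Us) \sum_(j in Ws) (G i j)%:R| <= p%:R * q%:R / (2 * N%:R) :> R ->
  exists flip : bool, forall key : 'I_p -> nat, injective key ->
    (forall i i', (key i < key i')%N ->
       if flip then (degree W i' <= degree W i)%N else (degree W i <= degree W i')%N) ->
    irregularity_witness G eps al (lowest key ((1 - al) * eps * p%:R)) W.
Proof.
move=> e0 al0 al1 hN hU hW hd WWs WsW hS.
set d := density R G [set: _] [set: _] in hd *.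
have [z|] := boolP ((p == 0)%N || (q == 0)%N).
  by move: hd; rewrite /d !(density_full_empty z) subrr normr0; lra.
rewrite negb_or -!lt0n => /andP[p0 q0].
have pR : 0 < p%:R :> R by rewrite ltr0n.
have qR : 0 < q%:R :> R by rewrite ltr0n.
have U0 : 0 < #|Us|%:R :> R by apply: lt_le_trans hU; rewrite mulr_gt0.
have Ws0 : 0 < #|Ws|%:R :> R by apply: lt_le_trans hW; rewrite mulr_gt0.
have e1 : eps <= 1.
  rewrite -(ler_pM2r pR) mul1r; apply: le_trans hU _.
  by rewrite ler_nat -[X in (_ <= X)%N]card_ord max_card.
have d01 : 0 <= d <= 1 by exact: density_bounds.
have N0 : 0 < N%:R :> R.
  rewrite ltr0n lt0n; apply/negP => /eqP z; move: hN; rewrite z mul0r; lra.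
set y := N%:R^-1 : R.
have y0 : 0 < y by rewrite invr_gt0.
have yb : y <= eps * eps * eps * al by rewrite /y -[X in X <= _]mul1r ler_pdivrMr // mulrC.
have eq4 : q%:R / (4 * N%:R) = q%:R * y / 4 by rewrite /y; field; rewrite gt_eqF.
have eq2 : p%:R * q%:R / (2 * N%:R) = p%:R * q%:R * y / 2.
  by rewrite /y; field; rewrite gt_eqF.
rewrite eq4 in WsW; rewrite eq2 in hS.
(* This keeps [W] large enough: |Ws| - |W| is at most a quarter of al eps q, and since al <= 1 / 2
   at most eps q / 8, whence the factor 7 / 8. *)
have ye : y <= eps * al.
  apply: le_trans yb _; rewrite -mulrA -[X in _ <= X]mul1r.
  by rewrite ler_wpM2r ?mulr_ile1 ?mulr_ge0 // ltW.
have qy : q%:R * y <= q%:R * (eps * al) by rewrite ler_wpM2l.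
have qe : q%:R * (eps * al) <= q%:R * eps / 2.
  by rewrite mulrA ler_wpM2l ?mulr_ge0 ?(ltW e0) //; lra.
set w := #|W|%:R : R in WWs WsW; set u := #|Us|%:R : R in hU U0.
set ws := #|Ws|%:R : R in WsW WWs hW Ws0.
have qe0 : 0 < q%:R * eps by rewrite mulr_gt0.
have w78 : 7 / 8 * (q%:R * eps) <= w by lra.
have w0 : 0 < w by lra.
have wal : (1 - al) * eps * q%:R <= w by lra.
(* Here 3 / 4 = 1 / 2 + 1 / 4 is the total loss in units of pq / N, and it is beaten by the 7 / 8
   from the size of [W]. *)
have gap : p%:R * q%:R * y * (3 / 4) < al * eps * (u * w).
  have h1 : p%:R * q%:R * y <= p%:R * q%:R * (eps * eps * eps * al).
    by rewrite ler_wpM2l // mulr_ge0.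
  have h2 : eps * p%:R * (7 / 8 * (q%:R * eps)) <= u * w.
    by apply: ler_pM => //; [rewrite mulr_ge0 // ltW | lra].
  have h3 : al * eps * (eps * p%:R * (7 / 8 * (q%:R * eps))) <= al * eps * (u * w).
    by rewrite ler_wpM2l // mulr_ge0 // ltW.
  have h4 : 0 < p%:R * q%:R * (eps * eps * eps * al) by rewrite !mulr_gt0.
  have h5 : al * eps * (eps * p%:R * (7 / 8 * (q%:R * eps)))
    = 7 / 8 * (p%:R * q%:R * (eps * eps * eps * al)) by field.
  by rewrite h5 in h3; lra.
have uw0 : 0 < u * w by rewrite mulr_gt0.
have ud : u * (q%:R * y / 4) <= p%:R * (q%:R * y / 4).
  rewrite ler_wpM2r ?divr_ge0 ?mulr_ge0 ?(ltW y0) //.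
  by rewrite ler_nat -[X in (_ <= X)%N]card_ord max_card.
pose S := \sum_(i in Us) \sum_(j in Ws) (G i j)%:R : R.
pose S' := \sum_(i in Us) \sum_(j in W) (G i j)%:R : R.
have dS : density R G Us Ws * (u * ws) = S.
  by rewrite /density edge_countE divfK // mulf_neq0 // gt_eqF.
have {hS} /ler_normlP[hS1 hS2] : `|S' - S| <= p%:R * q%:R * y / 2 := hS.
have degE U : \sum_(i in U) (degree W i)%:R = \sum_(i in U) \sum_(j in W) (G i j)%:R :> R.
  by apply: eq_bigr => i _; rewrite natr_sum.
have deg_le i : (degree W i)%:R <= w.
  by rewrite /w -sum1_card !natr_sum; apply: ler_sum => j _; case: (G i j).
have xU : (1 - al) * eps * p%:R <= u.
  apply: le_trans hU; rewrite ler_wpM2r // -[X in _ <= X]mul1r ler_wpM2r ?(ltW e0) //; lra.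
have Us0 : Us != set0 by rewrite -card_gt0 -(ltr_nat R).
have [hpos|hneg] := lerP 0 (density R G Us Ws - d); last first.
- exists false => key kinj kmono; set U := lowest key _.
  have mono i i' : (key i < key i')%N -> (degree W i)%:R <= (degree W i')%:R :> R.
    by move=> /kmono; rewrite ler_nat.
  have [c0 cx avg] := lowest_average kinj mono Us0 xU.
  rewrite ltr0_norm // in hd.
  set s := #|U|%:R : R in cx avg; have s0 : 0 < s by rewrite ltr0n.
  have dU : density R G U W * (s * w) = \sum_(i in U) (degree W i)%:R.
    by rewrite degE /density edge_countE divfK // mulf_neq0 // gt_eqF.
  rewrite (degE Us) -/S' -dU in avg.
  have dU0 : 0 <= density R G Us Ws by case/andP: (density_bounds Us Ws).
  have S_le : S <= (d - eps) * (u * w) + p%:R * q%:R * y / 4.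
    rewrite -dS; apply: le_trans (_ : (d - eps) * (u * (w + q%:R * y / 4)) <= _).
      by apply: ler_pM => //; [rewrite mulr_ge0 // ltW | lra | rewrite ler_wpM2l // ltW].
    rewrite mulrDr mulrDr lerD2l.
    apply: le_trans (_ : 1 * (u * (q%:R * y / 4)) <= _); last by lra.
    by apply: ler_wpM2r; [rewrite mulr_ge0 ?divr_ge0 ?mulr_ge0 // ltW | lra].
  have S'_lt : S' < (d - (1 - al) * eps) * (u * w) by lra.
  have lt : density R G U W < d - (1 - al) * eps.
    rewrite -(ltr_pM2r (_ : 0 < u * (s * w))) ?mulr_gt0 //.
    have h1 : s * S' < s * ((d - (1 - al) * eps) * (u * w)) by rewrite ltr_pM2l.
    apply: le_lt_trans (_ : s * S' < _); first by rewrite mulrCA.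
    by rewrite (_ : _ * (u * (s * w)) = s * ((d - (1 - al) * eps) * (u * w))) //; ring.
  split; rewrite ?card_ord //; first by rewrite -!card_gt0 c0 -(ltr_nat R).
  by rewrite -/d distrC; apply: lt_le_trans (ler_norm _); lra.
- exists true => key kinj kmono; set U := lowest key _.
  (* Counting non-neighbours in [W] turns rows of high degree into the lowest ones. *)
  have mono i i' : (key i < key i')%N ->
      w - (degree W i)%:R <= w - (degree W i')%:R.
    by move=> /kmono hk; rewrite lerD2l lerN2 ler_nat.
  have [c0 cx avg] := lowest_average kinj mono Us0 xU.
  rewrite ger0_norm // in hd.
  set s := #|U|%:R : R in cx avg; have s0 : 0 < s by rewrite ltr0n.
  have dU : density R G U W * (s * w) = \sum_(i in U) (degree W i)%:R.
    by rewrite degE /density edge_countE divfK // mulf_neq0 // gt_eqF.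
  have sumB (V : {set 'I_p}) : \sum_(i in V) (w - (degree W i)%:R) =
      #|V|%:R * w - \sum_(i in V) (degree W i)%:R by rewrite sumrB sumr_const mulr_natl.
  rewrite !sumB (degE Us) -/S' -dU -/u -/s in avg.
  have S_ge : (d + eps) * (u * w) <= S.
    by rewrite -dS; apply: ler_pM; rewrite ?mulr_ge0 ?addr_ge0 ?ler_wpM2l //; lra.
  have S'_gt : (d + (1 - al) * eps) * (u * w) < S' by lra.
  have gt : d + (1 - al) * eps < density R G U W.
    rewrite -(ltr_pM2r (_ : 0 < u * (s * w))) ?mulr_gt0 //.
    have h1 : s * ((d + (1 - al) * eps) * (u * w)) < s * S' by rewrite ltr_pM2l.
    apply: lt_le_trans (_ : s * S' <= _); last by rewrite !mulrBr in avg; lra.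
    by rewrite (_ : _ * (u * (s * w)) = s * ((d + (1 - al) * eps) * (u * w))) //; ring.
  split; rewrite ?card_ord //; first by rewrite -!card_gt0 c0 -(ltr_nat R).
  by rewrite -/d; apply: lt_le_trans (ler_norm _); lra.
Qed.

End Witness.

(** * The program *)

Section Rules.
Variables (R : realType) (w : nat).
Implicit Types (s : state R) (Q : state R -> Prop).

Definition rput (v : nat) (x : R) s : state R := State (imem s) (upd (rmem s) v 0%N x).

Definition store (a i x : nat) s : state R := State (upd (imem s) a i x) (rmem s).

Lemma ieval_var s v : ieval w s (var v) = imem s v 0.
Proof. by rewrite /= mod0n. Qed.

Lemma reval_rvar s v : reval w s (rvar v) = rmem s v 0.
Proof. by rewrite /= mod0n. Qed.

Lemma beval_blt s e1 e2 : beval w s (blt e1 e2) = (ieval w s e1 < ieval w s e2)%N.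
Proof. by rewrite /= ltnNge. Qed.

Lemma runs_setvar v e s Q : Q (put v (ieval w s e) s) ->
  runs w (setvar v e) s (icost e).+2 Q.
Proof. by move=> h; apply: runs_iset; rewrite /= ?mod0n // addnC addn1. Qed.

Lemma runs_rsetvar v e s Q : Q (rput v (reval w s e) s) ->
  runs w (rsetvar v e) s (rcost e).+2 Q.
Proof. by move=> h; apply: runs_rset; rewrite /= ?mod0n // addnC addn1. Qed.

Lemma runs_store a i e s Q : Q (store a (ieval w s i) (ieval w s e) s) ->
  runs w (ISet a i e) s (icost i + icost e).+1 Q.
Proof. by move=> h; apply: runs_iset. Qed.

(** Unlike [runs_seq] this leaves no inequality. After [runs_time; last first], unification
    assembles the time of a whole program, and it is compared with the claimed bound once, at the
    end. *)
Lemma runs_bind c1 c2 s T1 T2 Q :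
  runs w c1 s T1 (fun s1 => runs w c2 s1 T2 Q) -> runs w (Seq c1 c2) s (T1 + T2) Q.
Proof. by move=> h; apply: runs_seq h _. Qed.

(** Adds the frame to what is known afterwards, so a specification need only mention cells that
    change. *)
Lemma runs_conseq c s T Q Q' :
  runs w c s T Q -> (forall s', frame c s s' -> Q s' -> Q' s') -> runs w c s T Q'.
Proof.
move=> [s' [t [h1 h2 h3]]] h; exists s', t; split=> //.
by apply: h => //; exact: exec_frame h1.
Qed.

Lemma runs_time c s T T' Q : (T <= T')%N -> runs w c s T Q -> runs w c s T' Q.
Proof. by move=> h h'; apply: runs_weaken h' h _. Qed.

End Rules.

(** * Text of the algorithm *)

Definition arg_p : iexp := IGet 0 (ILit 0).
Definition arg_q : iexp := IGet 0 (ILit 1).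
Definition adj_at (i j : iexp) : iexp := IGet 1 (IAdd (IMul i arg_q) j).

(* Array names: v... for integer arrays, r... for real ones.  The input and output
   conventions fix integer arrays 0 to 4 and real array 0. *)
Notation vL := 5%N (only parsing).
Notation vKeep := 6%N (only parsing).
Notation vDrop := 7%N (only parsing).
Notation vN := 8%N (only parsing).
Notation vK := 9%N (only parsing).
Notation vB := 10%N (only parsing).
Notation vLen := 11%N (only parsing).
Notation vi := 12%N (only parsing).
Notation vk := 13%N (only parsing).
Notation vj := 14%N (only parsing).
Notation vHalf := 15%N (only parsing).
Notation vx := 16%N (only parsing).
Notation vy := 17%N (only parsing).
Notation vCode := 18%N (only parsing).
Notation vPK := 19%N (only parsing).
Notation vR := 20%N (only parsing).
Notation vg := 21%N (only parsing).
Notation vM := 22%N (only parsing).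
Notation vTrials := 23%N (only parsing).
Notation vRank := 24%N (only parsing).
Notation vCell := 25%N (only parsing).
Notation vt := 26%N (only parsing).
Notation vRest := 27%N (only parsing).
Notation vBit := 28%N (only parsing).
Notation vDeg := 29%N (only parsing).
Notation vKey := 30%N (only parsing).
Notation vWc := 31%N (only parsing).
Notation vUc := 32%N (only parsing).
Notation vh := 33%N (only parsing).
Notation rAl := 1%N (only parsing).
Notation rBeta := 2%N (only parsing).
Notation rXK := 3%N (only parsing).
Notation rXD := 4%N (only parsing).
Notation rYK := 5%N (only parsing).
Notation rYD := 6%N (only parsing).
Notation rGap := 7%N (only parsing).
Notation rTot := 8%N (only parsing).
Notation rEdges := 9%N (only parsing).

Definition add_product (r : nat) (x y : iexp) : cmd :=
  rsetvar r (RAdd (rvar r)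
    (RMul (RInt (adj_at x (var vj))) (RInt (adj_at y (var vj))))).

Definition dot_products : cmd :=
  Seq (rsetvar rXK (RInt (ILit 0))) (Seq (rsetvar rXD (RInt (ILit 0)))
  (Seq (rsetvar rYK (RInt (ILit 0))) (Seq (rsetvar rYD (RInt (ILit 0)))
  (For vj arg_q
    (Seq (add_product rXK (var vx) (IGet vKeep (var vh)))
    (Seq (add_product rXD (var vx) (IGet vDrop (var vh)))
    (Seq (add_product rYK (var vy) (IGet vKeep (var vh)))
         (add_product rYD (var vy) (IGet vDrop (var vh)))))))))).

(* [rGap] is the score of [x] minus that of [y], where the score of a row measures
   its correlation with the choices made so far in the block. *)
Definition pair_step : cmd :=
  Seq (setvar vx (IGet vL (IMul (ILit 2) (var vi))))
  (Seq (setvar vy (IGet vL (IAdd (IMul (ILit 2) (var vi)) (ILit 1))))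
  (Seq (rsetvar rGap (RInt (ILit 0)))
  (Seq (For vk (IMod (var vi) (var vB))
    (Seq (setvar vh (IAdd (ISub (var vi) (IMod (var vi) (var vB))) (var vk)))
    (Seq dot_products
         (rsetvar rGap (RAdd (rvar rGap)
            (RSub (RSub (RMul (rvar rXK) (rvar rXK)) (RMul (rvar rXD) (rvar rXD)))
                  (RSub (RMul (rvar rYK) (rvar rYK)) (RMul (rvar rYD) (rvar rYD)))))))))
  (If (BLer (rvar rGap) (RInt (ILit 0)))
    (Seq (ISet vKeep (var vi) (var vx)) (ISet vDrop (var vi) (var vy)))
    (Seq (ISet vKeep (var vi) (var vy)) (ISet vDrop (var vi) (var vx))))))).

Definition halve : cmd :=
  Seq (setvar vHalf (IDiv (var vLen) (ILit 2)))
  (Seq (For vi (var vHalf) pair_step)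
  (Seq (For vi (var vHalf) (ISet vL (var vi) (IGet vKeep (var vi))))
  (Seq (setvar vLen (var vHalf))
       (setvar vB (IAdd (var vB) (IDiv (var vB) (ILit 2))))))).

Definition sparsify : cmd := While (blt (var vK) (var vLen)) halve.

Definition eps_in : rexp := RGet 0 (ILit 0).
Definition alpha_in : rexp := RGet 0 (ILit 1).
Definition rone : rexp := RInt (ILit 1).

(** Without a floor operation, N is found by counting upwards with real comparisons; the number of
    rounds depends on eps and alpha only. *)
Definition find_scale : cmd :=
  Seq (If (BLer (RDiv rone (RInt (ILit 2))) alpha_in)
        (rsetvar rAl (RDiv rone (RInt (ILit 2)))) (rsetvar rAl alpha_in))
  (Seq (rsetvar rBeta (RMul (RMul (RMul eps_in eps_in) eps_in) (rvar rAl)))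
  (Seq (setvar vN (ILit 1))
  (While (BNot (BLer rone (RMul (RInt (var vN)) (rvar rBeta))))
     (setvar vN (IAdd (var vN) (ILit 1)))))).

Definition sqrt_size : iexp := IMul (IMul (ILit 400) (var vN)) (var vN).

Definition init_rows : cmd :=
  Seq (setvar vK (IMul sqrt_size sqrt_size))
  (Seq (setvar vB (var vK))
  (Seq (setvar vLen arg_p)
       (For vi arg_p (ISet vL (var vi) (var vi))))).

Definition init_sizes : cmd :=
  Seq (setvar vPK (ILit 1))
  (Seq (For vi (var vK) (setvar vPK (IMul (var vPK) (ILit 2))))
  (Seq (setvar vR (IMul (IMul (var vPK) (ILit 4)) (var vN)))
  (Seq (setvar vg (IAdd (IDiv arg_q (var vR)) (ILit 1)))
  (Seq (setvar vM (IMul (var vPK) (var vR)))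
  (Seq (setvar vTrials (ILit 2))
       (For vi (var vM) (setvar vTrials (IMul (var vTrials) (ILit 2))))))))).

Definition compute_codes : cmd :=
  For vj arg_q
    (Seq (ISet vCode (var vj) (ILit 0))
         (For vk (var vLen)
            (ISet vCode (var vj)
               (IAdd (IMul (ILit 2) (IGet vCode (var vj)))
                     (adj_at (IGet vL (var vk)) (var vj)))))).

Definition compute_cells : cmd :=
  For vj arg_q
    (Seq (setvar vRank (ILit 0))
    (Seq (For vk (var vj)
            (If (BAnd (BLei (IGet vCode (var vk)) (IGet vCode (var vj)))
                      (BLei (IGet vCode (var vj)) (IGet vCode (var vk))))
                (setvar vRank (IAdd (var vRank) (ILit 1))) Skip))
         (ISet vCell (var vj)
            (IAdd (IMul (IGet vCode (var vj)) (var vR)) (IDiv (var vRank) (var vg)))))).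

Definition total_edges : cmd :=
  Seq (rsetvar rTot (RInt (ILit 0)))
      (For vi arg_p (For vj arg_q
         (rsetvar rTot (RAdd (rvar rTot) (RInt (adj_at (var vi) (var vj))))))).

(* The square root of [sparse_size N] makes the total halving error
   24 / sqrt (sparse_size N) at most 1 / (16 N^2). *)
Definition read_bits : cmd :=
  Seq (setvar vRest (IDiv (var vt) (ILit 2)))
      (For vk (var vM)
        (Seq (ISet vBit (var vk) (IMod (var vRest) (ILit 2)))
             (setvar vRest (IDiv (var vRest) (ILit 2))))).

Definition build_W : cmd :=
  Seq (setvar vWc (ILit 0))
      (For vj arg_q
        (Seq (ISet 4 (var vj) (IGet vBit (IGet vCell (var vj))))
             (setvar vWc (IAdd (var vWc) (IGet 4 (var vj)))))).

(* The lowest bit of [t] selects vertices of low or of high degree into W, the other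
   bits select the cells that make up W. *)
Definition key_base : iexp :=
  IAdd (IMul (IMod (var vt) (ILit 2)) (ISub arg_q (IGet vDeg (var vi))))
       (IMul (ISub (ILit 1) (IMod (var vt) (ILit 2))) (IGet vDeg (var vi))).

Definition build_keys : cmd :=
  For vi arg_p
    (Seq (ISet vDeg (var vi) (ILit 0))
    (Seq (For vj arg_q
           (ISet vDeg (var vi) (IAdd (IGet vDeg (var vi))
              (IMul (adj_at (var vi) (var vj)) (IGet 4 (var vj))))))
         (ISet vKey (var vi) (IAdd (IMul key_base arg_p) (var vi))))).

Definition slack : rexp := RMul (RSub rone (rvar rAl)) eps_in.

(** Ranks are found by counting over all pairs of rows instead of sorting: O(p^2) steps are
    affordable, as the number of trials does not depend on n. *)
Definition build_U : cmd :=
  Seq (setvar vUc (ILit 0))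
  (Seq (rsetvar rEdges (RInt (ILit 0)))
  (For vi arg_p
    (Seq (setvar vRank (ILit 0))
    (Seq (For vk arg_p
           (If (blt (IGet vKey (var vk)) (IGet vKey (var vi)))
               (setvar vRank (IAdd (var vRank) (ILit 1))) Skip))
    (If (BAnd (BLei (ILit 1) (var vRank))
              (BLer (RMul slack (RInt arg_p)) (RInt (var vRank))))
        (ISet 3 (var vi) (ILit 0))
        (Seq (ISet 3 (var vi) (ILit 1))
        (Seq (setvar vUc (IAdd (var vUc) (ILit 1)))
             (rsetvar rEdges (RAdd (rvar rEdges) (RInt (IGet vDeg (var vi)))))))))))).

Definition deviation : rexp :=
  RSub (RDiv (rvar rEdges) (RMul (RInt (var vUc)) (RInt (var vWc))))
       (RDiv (rvar rTot) (RMul (RInt arg_p) (RInt arg_q))).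

(** The comparisons are exact, so soundness of a witness depends on no estimate. The negated
    conjunction expresses that the absolute deviation exceeds [slack]. *)
Definition test_witness : cmd :=
  If (BAnd (BLei (ILit 1) (var vUc)) (BAnd (BLei (ILit 1) (var vWc))
     (BAnd (BLer (RMul slack (RInt arg_p)) (RInt (var vUc)))
     (BAnd (BLer (RMul slack (RInt arg_q)) (RInt (var vWc)))
           (BNot (BAnd (BLer deviation slack)
                       (BLer (RSub (RInt (ILit 0)) deviation) slack)))))))
    (setvar 2 (ILit 1)) Skip.

Definition trial : cmd :=
  Seq read_bits (Seq build_W (Seq build_keys (Seq build_U test_witness))).

(** Trials after a success are skipped, since they would overwrite the witness in arrays 3 and 4. *)
Definition search : cmd :=
  For vt (var vTrials) (If (BLei (var 2) (ILit 0)) trial Skip).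

Definition algorithm : cmd :=
  Seq find_scale (Seq init_rows (Seq init_sizes (Seq sparsify
  (Seq compute_codes (Seq compute_cells (Seq total_edges search)))))).

(** * The constants as functions of N *)

Definition sparse_size (N : nat) : nat := ((400 * N * N) ^ 2)%N.
Definition patterns (N : nat) : nat := (2 ^ sparse_size N)%N.
(* Cells have q %/ cell_stride N + 1 elements, so rounding down to full cells in
   each of the [patterns N] atoms loses at most q / (4 N) elements in all. *)
Definition cell_stride (N : nat) : nat := (patterns N * 4 * N)%N.
Definition cells (N : nat) : nat := (patterns N * cell_stride N)%N.
(** One bit for each cell and one for the direction of the extremal U. *)
Definition trials (N : nat) : nat := (2 ^ (cells N).+1)%N.

Fixpoint pattern_code (b : nat -> nat) (m : nat) : nat :=
  if m is m'.+1 then (2 * pattern_code b m' + b m')%N else 0%N.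

Lemma pattern_code_lt b m : (forall s, (s < m)%N -> (b s <= 1)%N) ->
  (pattern_code b m < 2 ^ m)%N.
Proof.
elim: m => [|m IH] hb //=.
by have := IH (fun s hs => hb s (ltnW hs)); have := hb m (ltnSn m); rewrite expnS; lia.
Qed.

(** Columns with the same code agree on every sampled row, which is what makes the classes of equal
    code atoms. *)
Lemma pattern_code_inj b b' m : (forall s, (b s <= 1)%N) -> (forall s, (b' s <= 1)%N) ->
  pattern_code b m = pattern_code b' m -> forall s, (s < m)%N -> b s = b' s.
Proof.
move=> hb hb'; elim: m => [|m IH] //= h s; have := hb m; have := hb' m => h1 h2.
by rewrite ltnS leq_eqVlt => /orP[/eqP->|hs]; [lia | apply: IH => //; lia].
Qed.

Section Input.
Variables (R : realType) (p q : nat) (G : 'I_p -> 'I_q -> bool) (eps alpha : R).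

Definition adj (i j : nat) : nat := imem (input_state G eps alpha) 1 (i * q + j).

Lemma adjE (i : 'I_p) (j : 'I_q) : adj i j = G i j.
Proof.
rewrite /adj /=; congr nat_of_bool; apply/existsP/idP => [[i' /existsP[j' /andP[/eqP h g]]]|g].
  have qi : (0 < q)%N by apply: leq_ltn_trans (ltn_ord j).
  have ei : i = i'.
    apply/val_inj; move/(congr1 (divn^~ q)): h.
    by rewrite !divnMDl // !divn_small // !addn0.
  have ej : j = j'.
    by apply/val_inj; move/(congr1 (modn^~ q)): h; rewrite !modnMDl !modn_small.
  by rewrite ei ej.
by exists i; apply/existsP; exists j; rewrite eqxx.
Qed.

End Input.

(** * Its correctness *)

Section Programs.
Variables (R : realType) (w n p q : nat) (G : 'I_p -> 'I_q -> bool) (eps alpha : R).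
Hypothesis n0 : (0 < n)%N.
Hypothesis pn : (p <= n)%N.
Hypothesis qn : (q <= n)%N.
Hypothesis word_n : (8 * (n * n) <= 2 ^ w)%N.
Implicit Types (s : state R) (Q : state R -> Prop).

Local Notation inp := (input_state G eps alpha).
Local Notation A := (adj G eps alpha).

Definition a (i j : nat) : R := (A i j)%:R.

Lemma a01 i j : 0 <= a i j <= 1.
Proof. by rewrite /a ler0n lern1 /adj /= leq_b1. Qed.

Definition input_kept s : Prop :=
  [/\ imem s 0 = imem inp 0, imem s 1 = imem inp 1 & rmem s 0 = rmem inp 0].

Lemma nn : (n <= n * n)%N.
Proof. by rewrite -{1}(muln1 n) leq_mul2l n0 orbT. Qed.

Lemma mod1w : (1 %% 2 ^ w)%N = 1%N.
Proof. by rewrite modn_small //; have := nn; lia. Qed.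

Lemma mod2w : (2 %% 2 ^ w)%N = 2%N.
Proof. by rewrite modn_small //; have := nn; lia. Qed.

Lemma lt_word x : (x <= n)%N -> (x < 2 ^ w)%N.
Proof. by have := nn; lia. Qed.

Lemma ieval_p s : input_kept s -> ieval w s arg_p = p.
Proof. by case=> h _ _; rewrite /= mod0n h. Qed.

Lemma ieval_q s : input_kept s -> ieval w s arg_q = q.
Proof. by case=> h _ _; rewrite /= mod1w h. Qed.

Lemma index_lt i j : (i < p)%N -> (j < q)%N -> (i * q + j < n * n)%N.
Proof.
move=> hi hj; apply: (@leq_trans (p * q)); last exact: leq_mul.
by apply: (@leq_trans (i.+1 * q)); [rewrite mulSn; lia | rewrite leq_mul2r hi orbT].
Qed.

Lemma ieval_adj s x y i j : input_kept s -> ieval w s x = i -> ieval w s y = j ->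
  (i < p)%N -> (j < q)%N -> ieval w s (adj_at x y) = A i j.
Proof.
move=> ctx hx hy hi hj; have hij := index_lt hi hj; have := ieval_q ctx.
move: ctx => [_ h1 _]; rewrite /adj_at /= => ->.
by rewrite hx hy h1 (modn_small (m := (i * q)%N)) ?modn_small //; lia.
Qed.

Lemma frame_input c s s' : frame c s s' ->
  0%N \notin imods c -> 1%N \notin imods c -> 0%N \notin rmods c ->
  input_kept s -> input_kept s'.
Proof.
by case=> hi hr h0 h1 h2 [i0 i1 r0]; split; rewrite ?hi ?hr.
Qed.

Lemma input_kept_store v i k s : (1 < v)%N -> input_kept s -> input_kept (store v i k s).
Proof. by case: v => [|[|v]] // _ [i0 i1 r0]; split. Qed.

Lemma runs_zero v s Q : Q (put v 0 s) -> runs w (setvar v (ILit 0)) s 3 Q.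
Proof. by move=> h; apply: runs_setvar; rewrite /= mod0n. Qed.

Lemma runs_rzero v s Q : Q (rput v 0 s) -> runs w (rsetvar v (RInt (ILit 0))) s 4 Q.
Proof. by move=> h; apply: runs_rsetvar; rewrite /= mod0n. Qed.

Lemma runs_add_product r x y i i' j s Q : input_kept s ->
  ieval w s x = i -> ieval w s y = i' -> imem s vj 0 = j ->
  (i < p)%N -> (i' < p)%N -> (j < q)%N ->
  Q (rput r (rmem s r 0 + a i j * a i' j) s) ->
  runs w (add_product r x y) s (icost x + icost y + 30) Q.
Proof.
move=> ctx hx hy hj ip i'p jq hQ.
have hv : ieval w s (var vj) = j by rewrite ieval_var.
apply: runs_time; last first.
  apply: runs_rsetvar.
  change (Q (rput r (reval w s (rvar r) + (ieval w s (adj_at x (var vj)))%:R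
    * (ieval w s (adj_at y (var vj)))%:R) s)).
  by rewrite reval_rvar (ieval_adj ctx hx hv) // (ieval_adj ctx hy hv).
by rewrite /=; lia.
Qed.

Local Notation ip := (ip a q).

Lemma dot_products_spec s x y h kx dx :
  input_kept s -> imem s vx 0 = x -> imem s vy 0 = y -> imem s vh 0 = h ->
  imem s vKeep h = kx -> imem s vDrop h = dx ->
  (x < p)%N -> (y < p)%N -> (kx < p)%N -> (dx < p)%N ->
  runs w dot_products s (400 * n)
    (fun s' => [/\ rmem s' rXK 0 = ip x kx, rmem s' rXD 0 = ip x dx,
                   rmem s' rYK 0 = ip y kx & rmem s' rYD 0 = ip y dx]).
Proof.
move=> ctx hx hy hh hk hd xp yp kp dp.
apply: runs_time; last first.
  do 4 (apply: runs_bind; apply: runs_rzero).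
  apply: (@runs_for _ _ _ _ _ _ q _ _ (fun m s' =>
     [/\ rmem s' rXK 0 = \sum_(j < m) a x j * a kx j,
         rmem s' rXD 0 = \sum_(j < m) a x j * a dx j,
         rmem s' rYK 0 = \sum_(j < m) a y j * a kx j &
         rmem s' rYD 0 = \sum_(j < m) a y j * a dx j])).
  - by [].
  - exact: lt_word.
  - by move=> s1 f; apply: ieval_q; exact: frame_input f _ _ _ _.
  - by rewrite /= /upd /= !big_ord0.
  - move=> k s1 kq f vk [e1 e2 e3 e4].
    have ctx1 : input_kept s1 by exact: frame_input f _ _ _ _.
    have [fi _] := f.
    have hx1 : imem s1 vx 0 = x by rewrite fi.
    have hy1 : imem s1 vy 0 = y by rewrite fi.
    have hh1 : imem s1 vh 0 = h by rewrite fi.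
    have hk1 : imem s1 vKeep h = kx by rewrite fi.
    have hd1 : imem s1 vDrop h = dx by rewrite fi.
    apply: runs_bind.
    apply: (@runs_add_product _ _ _ x kx k); rewrite ?ieval_var /= ?mod0n ?hh1 //.
    apply: runs_bind.
    apply: (@runs_add_product _ _ _ x dx k); rewrite ?ieval_var /= ?mod0n ?hh1 //.
    apply: runs_bind.
    apply: (@runs_add_product _ _ _ y kx k); rewrite ?ieval_var /= ?mod0n ?hh1 //.
    apply: (@runs_add_product _ _ _ y dx k); rewrite ?ieval_var /= ?mod0n ?hh1 //.
    by rewrite /upd /= !big_ord_recr /= e1 e2 e3 e4.
  - exact: leqnn.
  - by move=> s1 f [e1 e2 e3 e4].
by rewrite /=; nia.
Qed.

Local Notation score := (score a q).

(** A score reads only earlier choices, so the balance achieved at pair [i] survives all later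
    writes. *)
Lemma score_ext B kp dr kp' dr' i x :
  (forall k, (k < i)%N -> kp k = kp' k) -> (forall k, (k < i)%N -> dr k = dr' k) ->
  score B kp dr i x = score B kp' dr' i x.
Proof.
move=> hk hd; apply: eq_bigr => k _.
have hlt : (i - i %% B + k < i)%N.
  by have := ltn_ord k; have := leq_mod i B; lia.
by rewrite hk // hd.
Qed.

Lemma pair_step_spec s i B len :
  input_kept s -> imem s vi 0 = i -> imem s vB 0 = B -> (0 < B)%N ->
  (i.*2.+1 < len)%N -> (len <= p)%N ->
  (forall k, (k < len)%N -> (imem s vL k < p)%N) ->
  (forall k, (k < i)%N -> (imem s vKeep k < p)%N /\ (imem s vDrop k < p)%N) ->
  runs w pair_step s (600 * (B * n)) (fun s' =>
    [/\ forall k, k != i ->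
          imem s' vKeep k = imem s vKeep k /\ imem s' vDrop k = imem s vDrop k,
        let x := imem s vL i.*2 in let y := imem s vL i.*2.+1 in
          (imem s' vKeep i = x /\ imem s' vDrop i = y) \/
          (imem s' vKeep i = y /\ imem s' vDrop i = x) &
        let sc := score B (imem s vKeep) (imem s vDrop) i in
        sc (imem s' vKeep i) <= sc (imem s' vDrop i)]).
Proof.
move=> ctx hi hB B0 hlen lenp hL hKD.
have := nn => hnn.
set x := imem s vL i.*2; set y := imem s vL i.*2.+1.
have xp : (x < p)%N by apply: hL; lia.
have yp : (y < p)%N by exact: hL.
have ex : ieval w s (IGet vL (IMul (ILit 2) (var vi))) = x.
  by rewrite /= mod0n mod2w hi modn_small /x ?mul2n //; lia.
have ey v : ieval w (put vx v s) (IGet vL (IAdd (IMul (ILit 2) (var vi)) (ILit 1))) = y.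
  by rewrite /= /upd /= mod0n mod2w mod1w hi mul2n addn1 !modn_small //; lia.
apply: runs_time; last first.
  apply: runs_bind; apply: runs_setvar; rewrite ex.
  apply: runs_bind; apply: runs_setvar; rewrite ey.
  apply: runs_bind; apply: runs_rzero.
  apply: runs_bind.
  apply: (@runs_for _ _ _ _ _ _ (i %% B)%N _ _ (fun m s' =>
    rmem s' rGap 0 = \sum_(k < m)
      ((ip x (imem s vKeep (i - i %% B + k)%N) ^+ 2
        - ip x (imem s vDrop (i - i %% B + k)%N) ^+ 2)
       - (ip y (imem s vKeep (i - i %% B + k)%N) ^+ 2
        - ip y (imem s vDrop (i - i %% B + k)%N) ^+ 2)))).
  - by [].
  - by apply: lt_word; have := leq_mod i B; lia.
  - move=> s1 [fi _]; have hi1 : imem s1 vi 0 = i by rewrite fi.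
    have hB1 : imem s1 vB 0 = B by rewrite fi.
    by rewrite /= mod0n hi1 hB1.
  - by rewrite /= /upd /= big_ord0.
  - move=> k s1 kB f hk e.
    have ctx1 : input_kept s1 by exact: frame_input f _ _ _ _.
    have [fi _] := f.
    have hh : (i - i %% B + k < i)%N by have := leq_mod i B; lia.
    have [kp dp] := hKD _ hh.
    apply: runs_bind; apply: runs_setvar.
    have -> : ieval w s1 (IAdd (ISub (var vi) (IMod (var vi) (var vB))) (var vk))
        = (i - i %% B + k)%N.
      have hi1 : imem s1 vi 0 = i by rewrite fi.
      have hB1 : imem s1 vB 0 = B by rewrite fi.
      by rewrite /= !mod0n hi1 hB1 hk modn_small //; lia.
    apply: runs_bind; apply: runs_conseq.
      apply: (@dot_products_spec _ x y (i - i %% B + k)%N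
        (imem s vKeep (i - i %% B + k)%N) (imem s vDrop (i - i %% B + k)%N)) => //.
      + by rewrite /= /upd /= fi.
      + by rewrite /= /upd /= fi.
      + by rewrite /= /upd /= fi.
      + by rewrite /= /upd /= fi.
    move=> s2 [_ fr2] [e1 e2 e3 e4]; apply: runs_rsetvar.
    have eg : rmem s2 rGap 0 = rmem s1 rGap 0 by rewrite fr2.
    by rewrite /= mod0n e1 e2 e3 e4 eg e /upd /= big_ord_recr /= -!expr2.
  - exact: leqnn.
  move=> s1 f e; have [fi _] := f.
  have hi1 : imem s1 vi 0 = i by rewrite fi.
  have hx1 : imem s1 vx 0 = x by rewrite fi.
  have hy1 : imem s1 vy 0 = y by rewrite fi.
  have hK1 : imem s1 vKeep = imem s vKeep by rewrite fi.
  have hD1 : imem s1 vDrop = imem s vDrop by rewrite fi.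
  rewrite sumrB in e.
  apply: runs_if; rewrite /= ?mod0n.
  - rewrite e subr_le0 => hle.
    apply: runs_bind; apply: runs_store; apply: runs_store.
    rewrite /= !mod0n /upd /= !hi1 hx1 hy1; split.
    + by move=> k /negbTE->; rewrite hK1 hD1.
    + by left; rewrite eqxx.
    + by rewrite eqxx.
  - rewrite e subr_le0 -ltNge => /ltW hle.
    apply: runs_bind; apply: runs_store; apply: runs_store.
    rewrite /= !mod0n /upd /= !hi1 hx1 hy1; split.
    + by move=> k /negbTE->; rewrite hK1 hD1.
    + by right; rewrite eqxx.
    + by rewrite eqxx.
  - exact: leqnn.
rewrite /=; have := ltn_pmod i B0.
by nia.
Qed.

Lemma halve_spec s B len :
  input_kept s -> imem s vLen 0 = len -> imem s vB 0 = B -> (1 < B)%N ->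
  (1 < len)%N -> (len <= p)%N -> (B + B %/ 2 < 2 ^ w)%N ->
  (forall k, (k < len)%N -> (imem s vL k < p)%N) ->
  runs w halve s (900 * (len * B * n)) (fun s' =>
    exists kp dr, [/\ split_pairs (imem s vL) len./2 kp dr,
      balanced a q B len./2 kp dr,
      forall k, (k < len./2)%N -> imem s' vL k = kp k,
      imem s' vLen 0 = len./2 & imem s' vB 0 = (B + B %/ 2)%N]).
Proof.
move=> ctx hlen hB B1 len1 lenp Bw hL.
have h2 : (len %/ 2)%N = len./2 by rewrite divn2.
have half_w : (len./2 < 2 ^ w)%N by apply: lt_word; lia.
have hhalf_lt i : (i < len./2)%N -> (i.*2.+1 < len)%N by lia.
apply: runs_time; last first.
  apply: runs_bind; apply: runs_setvar.
  have -> : ieval w s (IDiv (var vLen) (ILit 2)) = len./2.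
    by rewrite /= mod0n mod2w hlen h2.
  apply: runs_bind.
  apply: (@runs_for _ _ _ _ _ _ len./2 _ _ (fun m s' =>
    [/\ split_pairs (imem s vL) m (imem s' vKeep) (imem s' vDrop),
        balanced a q B m (imem s' vKeep) (imem s' vDrop) &
        forall k, (k < m)%N -> (imem s' vKeep k < p)%N /\ (imem s' vDrop k < p)%N])).
  - by [].
  - exact: half_w.
  - by move=> s1 [fi _]; rewrite ieval_var fi.
  - by split.
  - move=> i s1 hi f hvi [hs hb hp].
    have ctx1 : input_kept s1 by exact: frame_input f _ _ _ _.
    have [fi _] := f.
    have eL : imem s1 vL = imem s vL by rewrite fi.
    apply: runs_conseq.
      apply: (@pair_step_spec _ i B len) => //.
      + by rewrite fi.
      + exact: ltnW.
      + exact: hhalf_lt.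
      + by rewrite eL.
    rewrite /= eL => s2 _ [ext pick sc]; rewrite !upd_neq //; split.
    + move=> k; rewrite ltnS leq_eqVlt => /orP[/eqP->|hk]; first exact: pick.
      by have [-> ->] := ext k (ltac:(lia)); exact: hs.
    + move=> k; rewrite ltnS leq_eqVlt => /orP[/eqP->|hk].
        rewrite -!(@score_ext B (imem s1 vKeep) (imem s1 vDrop)) //.
        * by move=> k' hk'; have [-> _] := ext k' (ltac:(lia)).
        * by move=> k' hk'; have [_ ->] := ext k' (ltac:(lia)).
        * by move=> k' hk'; have [-> _] := ext k' (ltac:(lia)).
        * by move=> k' hk'; have [_ ->] := ext k' (ltac:(lia)).
      rewrite -!(@score_ext B (imem s1 vKeep) (imem s1 vDrop)).
      * by have [-> ->] := ext k (ltac:(lia)); exact: hb.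
      * by move=> k' hk'; have [-> _] := ext k' (ltac:(lia)).
      * by move=> k' hk'; have [_ ->] := ext k' (ltac:(lia)).
      * by move=> k' hk'; have [-> _] := ext k' (ltac:(lia)).
      * by move=> k' hk'; have [_ ->] := ext k' (ltac:(lia)).
    + move=> k; rewrite ltnS leq_eqVlt => /orP[/eqP->|hk].
        have h0 := hL i.*2 (ltnW (hhalf_lt i hi)); have h1 := hL _ (hhalf_lt i hi).
        by case: pick => -[-> ->].
      by have [-> ->] := ext k (ltac:(lia)); exact: hp.
  - exact: leqnn.
  move=> s1 f1 [hs hb hp].
  have hh1 : imem s1 vHalf 0 = len./2 by rewrite f1.1.
  have hB1 : imem s1 vB 0 = B by rewrite f1.1.
  apply: runs_bind.
  apply: (@runs_for _ _ _ _ _ _ len./2 _ _ (fun m s' =>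
    forall k, (k < m)%N -> imem s' vL k = imem s1 vKeep k)).
  - by [].
  - exact: half_w.
  - by move=> s2 [fi _]; rewrite ieval_var fi.
  - by [].
  - move=> i s2 hi [fi _] hvi e; apply: runs_store.
    move=> k; rewrite /= /upd /= mod0n hvi ltnS leq_eqVlt.
    case: eqP => [->|_] //= hk; last exact: e.
    by rewrite fi.
  - exact: leqnn.
  move=> s2 [fi _] e.
  have hh2 : imem s2 vHalf 0 = len./2 by rewrite fi.
  have hB2 : imem s2 vB 0 = B by rewrite fi.
  apply: runs_bind; apply: runs_setvar; rewrite ieval_var hh2.
  apply: runs_setvar; exists (imem s1 vKeep), (imem s1 vDrop).
  split=> //.
  rewrite /= /upd /= !mod0n !mod2w hB2 modn_small //.
rewrite /= /arg_q; have := nn.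
have : (len./2.+1 <= len)%N by lia.
have : (len <= len * (B * n))%N by rewrite leq_pmulr // muln_gt0; lia.
set z := (B * n)%N; rewrite -mulnA -/z => h h'.
have : (len./2.+1 * (600 * z) <= len * (600 * z))%N by rewrite leq_mul2r h' orbT.
by lia.
Qed.

(** A halving multiplies [len * B] by at most 3 / 4. Hence the times form a geometric series, with
    900 + 4000 (3/4) < 4000 leaving room for overhead, and [len * B] never outgrows a word. *)
Lemma sparsify_spec K len B s :
  (0 < K)%N -> (1 < B)%N -> (len <= p)%N -> (len * B < 2 ^ w)%N ->
  input_kept s -> imem s vLen 0 = len -> imem s vB 0 = B -> imem s vK 0 = K ->
  (forall k, (k < len)%N -> (imem s vL k < p)%N) ->
  runs w sparsify s (4000 * (len * B * n) + 20) (fun s' =>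
    exists om, [/\ (imem s' vLen 0 <= K)%N, (imem s' vLen 0 <= len)%N,
      forall k, (k < imem s' vLen 0)%N -> (imem s' vL k < p)%N &
      \sum_t `|gram a (q := q) (imem s vL) len t
               - om * gram a (imem s' vL) (imem s' vLen 0) t|
        <= halving_potential R K len B * q%:R ^+ 2]).
Proof.
move=> K0; elim/ltn_ind: len B s => len IH B s B1 lenp lBw ctx hlen hB hK hL.
have [hle|hlt] := leqP len K.
  apply: runs_while_false.
  - by rewrite beval_blt !ieval_var hlen hK -leqNgt.
  - exists 1; rewrite hlen /halving_potential hle mul0r; split=> //.
    by rewrite big1 // => t _; rewrite mul1r subrr normr0.
  - by rewrite /=; lia.
have len1 : (1 < len)%N by lia.
have hmul : (4 * (len./2 * (B + B %/ 2)) <= 3 * (len * B))%N.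
  have : (2 * len./2 <= len)%N by lia.
  have : (2 * (B + B %/ 2) <= 3 * B)%N by lia.
  by nia.
have hBw : (B + B %/ 2 < 2 ^ w)%N.
  have : (2 * B <= len * B)%N by rewrite leq_mul2r len1 orbT.
  by lia.
apply: (@runs_while_true _ _ _ _ _ (900 * (len * B * n))
  (4000 * (len./2 * (B + B %/ 2) * n) + 20)).
- by rewrite beval_blt !ieval_var hlen hK.
- apply: runs_conseq (halve_spec ctx hlen hB B1 len1 lenp hBw hL) _.
  move=> s1 f1 [kp [dr [hs hb hkeep hlen1 hB1]]].
  have hL1 k : (k < len./2)%N -> (imem s1 vL k < p)%N.
    move=> hk; rewrite hkeep //.
    by case: (hs k hk) => -[-> _]; apply: hL; lia.
  apply: runs_conseq.
    apply: (IH len./2 _ (B + B %/ 2)%N) => //; try by lia.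
    + exact: frame_input f1 _ _ _ _.
    + by rewrite f1.1.
  (* Each kept row stands for a pair, so the weight doubles per halving. It is never computed: the
     program uses only which rows survive. *)
  move=> s2 _ [om [h1 h2 h3 h4]]; exists (2 * om); split=> //; first by lia.
  have e1 := @halving_error R a q a01 (imem s vL) kp dr len B (ltnW B1) len1 hs hb.
  have eg t : gram a (q := q) (imem s1 vL) len./2 t = gram a kp len./2 t.
    by apply: eq_bigr => k _; rewrite hkeep.
  have q2 : 0 <= q%:R ^+ 2 :> R by exact: sqr_ge0.
  have tri : \sum_t `|gram a (q := q) (imem s vL) len t
        - 2 * om * gram a (imem s2 vL) (imem s2 vLen 0) t| <=
      \sum_t `|gram a (q := q) (imem s vL) len t - 2 * gram a kp len./2 t|
      + 2 * \sum_t `|gram a (q := q) (imem s1 vL) len./2 t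
        - om * gram a (imem s2 vL) (imem s2 vLen 0) t|.
    rewrite mulr_sumr -big_split /=; apply: ler_sum => t _; rewrite eg.
    set x := gram _ _ len _; set y := gram _ kp _ _; set z := gram _ _ (imem s2 _ _) _.
    rewrite -[X in _ + X * _](@ger0_norm _ 2) // -normrM.
    have -> : x - 2 * om * z = (x - 2 * y) + 2 * (y - om * z) by ring.
    exact: ler_normD.
  apply: le_trans tri _.
  have h5 := ler_wpM2r q2 (@halving_potential_step R K len B K0 B1 hlt).
  apply: le_trans h5; rewrite [X in _ <= X]mulrDl; apply: lerD.
    by rewrite mulrAC.
  by rewrite -mulrA; apply: ler_wpM2l.
- by rewrite /=; nia.
Qed.

(** * The scale N and the set-up phase *)

Variable N : nat.
(** The cap keeps 1 - alpha away from 0 even for large alpha; a witness for a smaller alpha is one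
    for a larger alpha. *)
Definition half_alpha : R := if 1 / 2 <= alpha then 1 / 2 else alpha.
Hypothesis N0 : (0 < N)%N.
Hypothesis N_scale : 1 <= N%:R * (eps * eps * eps * half_alpha).
Hypothesis N_min :
  forall m, (0 < m)%N -> 1 <= m%:R * (eps * eps * eps * half_alpha) -> (N <= m)%N.
Hypothesis word_N : (8 * (trials N * (n * n)) <= 2 ^ w)%N.

Lemma sizes_lt : [/\ (N < sparse_size N)%N, (sparse_size N < patterns N)%N,
  (patterns N <= cell_stride N)%N, (cell_stride N <= cells N)%N &
  (cells N < trials N)%N].
Proof.
have P0 : (0 < patterns N)%N by rewrite expn_gt0.
have NN : (N <= N * N)%N by rewrite leq_pmulr.
have hs : (N < 400 * N * N)%N by rewrite -mulnA; lia.
split.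
- by rewrite /sparse_size -mulnn; apply: leq_trans hs _; rewrite leq_pmulr //; lia.
- exact: ltn_expl.
- by rewrite /cell_stride -mulnA leq_pmulr //; lia.
- by rewrite /cells leq_pmull.
- by rewrite /trials expnS; have := ltn_expl (cells N) (isT : 1 < 2)%N; lia.
Qed.

Lemma lt_word_N x y : (x <= trials N)%N -> (y <= 2 * n)%N -> (x * y < 2 ^ w)%N.
Proof.
move=> hx hy; apply: leq_trans word_N.
have T0 : (0 < trials N)%N by rewrite expn_gt0.
have := leq_mul hx hy; have : (trials N * n <= trials N * (n * n))%N by rewrite leq_mul2l nn orbT.
have : (0 < trials N * (n * n))%N by rewrite !muln_gt0 T0 n0.
by lia.
Qed.

Lemma lt_word_trials x : (x <= 2 * trials N)%N -> (x < 2 ^ w)%N.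
Proof.
have /= := @lt_word_N (trials N) 2 (leqnn _).
by have : (2 <= 2 * n)%N by [lia]; move=> h /(_ h); lia.
Qed.

Lemma find_scale_spec s : input_kept s ->
  runs w find_scale s (100 * N) (fun s' =>
    imem s' vN 0 = N /\ rmem s' rAl 0 = half_alpha).
Proof.
move=> ctx; have [hN _ _ _ _] := sizes_lt.
have [_ _ r0] := ctx.
have hw1 := mod1w; have hw2 := mod2w.
apply: runs_time; last first.
  apply: runs_bind; apply: (@runs_conseq _ _ _ _ _ (fun s' => rmem s' rAl 0 = half_alpha)).
    apply: runs_if; rewrite /= ?hw1 ?hw2 ?r0 /=.
    - by move=> h; apply: runs_rsetvar; rewrite /= hw1 hw2 /half_alpha h.
    - move=> h; apply: runs_time; last apply: runs_rsetvar.
        by [].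
      by rewrite /= r0 hw1 /= /half_alpha (negbTE h).
    - exact: leqnn.
  move=> s1 [_ fr] eal.
  have r1 : rmem s1 0 = rmem inp 0 by rewrite fr.
  apply: runs_bind; apply: runs_rsetvar.
  have -> : reval w s1 (RMul (RMul (RMul eps_in eps_in) eps_in) (rvar rAl)) =
      eps * eps * eps * half_alpha by rewrite /= !mod0n r1 eal.
  apply: runs_bind; apply: runs_setvar.
  have -> s2 : ieval w s2 (ILit 1) = 1%N by rewrite /= hw1.
  set beta := (eps * eps * eps * half_alpha).
  have loop d : forall k s2, (k + d = N)%N -> (0 < k)%N -> imem s2 vN 0 = k ->
      rmem s2 rBeta 0 = beta -> rmem s2 rAl 0 = half_alpha ->
      runs w (While (BNot (BLer rone (RMul (RInt (var vN)) (rvar rBeta))))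
        (setvar vN (IAdd (var vN) (ILit 1)))) s2 (d * 40 + 20)%N
        (fun s' => imem s' vN 0 = N /\ rmem s' rAl 0 = half_alpha).
    elim: d => [|d IH] k s2 hk k0 e1 e2 e3.
      rewrite addn0 in hk; subst k; apply: runs_while_false => //=.
      by rewrite hw1 !mod0n e2 hk negbK.
    apply: (@runs_while_true _ _ _ _ _ 10 (d * 40 + 20)).
    - rewrite /= hw1 !mod0n e1 e2; apply/negP => /(N_min k0); lia.
    - apply: runs_time; last first.
        apply: runs_setvar; rewrite /= mod0n hw1 e1 modn_small; last first.
          by apply: lt_word_trials; have [? ? ? ? ?] := sizes_lt; lia.
        rewrite addn1; apply: (IH k.+1) => //=; first by lia.
      by [].
    - by rewrite /=; lia.
  by apply: (loop N.-1 1%N) => //; lia.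
by rewrite /=; lia.
Qed.

Lemma init_rows_spec s : input_kept s -> imem s vN 0 = N ->
  runs w init_rows s (100 * n) (fun s' =>
    [/\ imem s' vK 0 = sparse_size N, imem s' vB 0 = sparse_size N,
        imem s' vLen 0 = p & forall k, (k < p)%N -> imem s' vL k = k]).
Proof.
move=> ctx hN; have [h1 h2 h3 h4 h5] := sizes_lt.
have K_w : (sparse_size N < 2 ^ w)%N by apply: lt_word_trials; lia.
have s_w : (400 * N * N < 2 ^ w)%N.
  by apply: leq_ltn_trans K_w; rewrite /sparse_size -mulnn leq_pmulr // !muln_gt0 N0.
have hw400 : (400 %% 2 ^ w)%N = 400%N by rewrite modn_small //; move: s_w; rewrite -mulnA; have : (0 < N * N)%N by [rewrite muln_gt0 N0]; lia.
have eS : ieval w s sqrt_size = (400 * N * N)%N.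
  by rewrite /= !mod0n hN hw400 (modn_small (m := (400 * N)%N)) ?modn_small //; apply: leq_ltn_trans s_w; rewrite leq_pmulr.
apply: runs_time; last first.
  apply: runs_bind; apply: runs_setvar.
  have -> : ieval w s (IMul sqrt_size sqrt_size) = sparse_size N.
    have -> : ieval w s (IMul sqrt_size sqrt_size) =
      ((ieval w s sqrt_size * ieval w s sqrt_size) %% 2 ^ w)%N by [].
    by rewrite eS mulnn modn_small.
  apply: runs_bind; apply: runs_setvar; rewrite ieval_var.
  apply: runs_bind; apply: runs_setvar; rewrite ieval_p //.
  apply: (@runs_for _ _ _ _ _ _ p _ _ (fun m s' =>
     forall k, (k < m)%N -> imem s' vL k = k)).
  - by [].
  - exact: lt_word.
  - by move=> s1 f; apply: ieval_p; exact: frame_input f _ _ _ _.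
  - by [].
  - move=> i s1 hi _ hvi e; apply: runs_store => k.
    rewrite /= /upd /= mod0n hvi ltnS leq_eqVlt.
    by case: eqP => [->|_] //= hk; exact: e.
  - exact: leqnn.
  - move=> s1 [fi _] e; split=> //; rewrite fi //.
by rewrite /=; nia.
Qed.

Lemma runs_doubling v u m c s :
  v != vi -> u != vi -> u != v -> imem s u 0 = m -> imem s v 0 = c ->
  (0 < c)%N -> (c * 2 ^ m < 2 ^ w)%N ->
  runs w (For vi (var u) (setvar v (IMul (var v) (ILit 2)))) s (m.+1 * 30)
    (fun s' => imem s' v 0 = (c * 2 ^ m)%N).
Proof.
move=> vvi uvi uv hm hc c0 hw.
apply: (@runs_for _ _ _ _ _ _ m _ _ (fun k s' => imem s' v 0 = (c * 2 ^ k)%N)).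
- by rewrite inE eq_sym.
- apply: leq_ltn_trans hw; apply: leq_trans (ltnW (ltn_expl m (isT : 1 < 2)%N)) _.
  by rewrite leq_pmull.
- move=> s1 [fi _]; rewrite ieval_var fi // !inE negb_or uvi /= negb_or.
  by rewrite uv.
- by rewrite /= upd_neq // hc muln1.
- move=> k s1 km _ _ e; apply: runs_setvar => /=.
  rewrite upd_neq // /upd !eqxx /= mod0n mod2w e.
  rewrite modn_small -?mulnA -?expnSr //.
  by apply: leq_ltn_trans hw; rewrite leq_mul2l leq_exp2l // orbC km.
- by rewrite /=; lia.
- by move=> s1 _.
Qed.

Lemma init_sizes_spec s : input_kept s -> imem s vN 0 = N -> imem s vK 0 = sparse_size N ->
  runs w init_sizes s (100 * cells N) (fun s' =>
    [/\ imem s' vR 0 = cell_stride N, imem s' vg 0 = (q %/ cell_stride N).+1,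
        imem s' vM 0 = cells N & imem s' vTrials 0 = trials N]).
Proof.
move=> ctx hN hK; have [h1 h2 h3 h4 h5] := sizes_lt.
have hw1 := mod1w; have hw2 := mod2w.
have hw4 : (4 %% 2 ^ w)%N = 4%N by rewrite modn_small //; have := nn; lia.
have w_lt x : (x <= trials N)%N -> (x < 2 ^ w)%N by move=> h; apply: lt_word_trials; lia.
apply: runs_time; last first.
  apply: runs_bind; apply: runs_setvar; rewrite /= hw1.
  apply: runs_bind; apply: runs_conseq.
    apply: (@runs_doubling vPK vK (sparse_size N) 1) => //.
    by rewrite mul1n; apply: w_lt; rewrite -/(patterns N); lia.
  rewrite mul1n -/(patterns N) => s1 f1 ePK.
  have ctx1 : input_kept s1 by exact: frame_input f1 _ _ _ _.
  have hN1 : imem s1 vN 0 = N by rewrite f1.1.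
  apply: runs_bind; apply: runs_setvar.
  have -> : ieval w s1 (IMul (IMul (var vPK) (ILit 4)) (var vN)) = cell_stride N.
    rewrite /= !mod0n hw4 ePK hN1 (modn_small (m := (patterns N * 4)%N)).
      by rewrite modn_small //; apply: w_lt; rewrite -/(cell_stride N); lia.
    by apply: w_lt; apply: leq_trans (_ : cell_stride N <= _)%N; [rewrite leq_pmulr | lia].
  apply: runs_bind; apply: runs_setvar.
  have -> : ieval w (put vR (cell_stride N) s1) (IAdd (IDiv arg_q (var vR)) (ILit 1)) =
      (q %/ cell_stride N).+1.
    have := ieval_q ctx1; rewrite /= /upd /= => ->.
    rewrite mod0n hw1 addn1 modn_small //.
    by have := leq_div q (cell_stride N); have := nn; lia.
  apply: runs_bind; apply: runs_setvar.
  rewrite [ieval _ _ _](_ : _ = cells N); last first.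
    by rewrite /= /upd /= mod0n ePK modn_small //; apply: w_lt; rewrite -/(cells N); lia.
  apply: runs_bind; apply: runs_setvar; rewrite /= hw2.
  apply: runs_conseq.
    apply: (@runs_doubling vTrials vM (cells N) 2) => //.
    by rewrite -expnS; apply: w_lt; rewrite -/(trials N).
  by rewrite -expnS -/(trials N) => s2 [fi _] e; split=> //; rewrite fi.
by rewrite /=; lia.
Qed.

Lemma compute_codes_spec s len : input_kept s -> imem s vLen 0 = len ->
  (len <= sparse_size N)%N -> (len <= p)%N ->
  (forall k, (k < len)%N -> (imem s vL k < p)%N) ->
  runs w compute_codes s (100 * (n * (sparse_size N).+1)) (fun s' =>
    forall j, (j < q)%N ->
      imem s' vCode j = pattern_code (fun k => A (imem s vL k) j) len).
Proof.
move=> ctx hlen lenK lenp hL; have [h1 h2 h3 h4 h5] := sizes_lt.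
have A1 i j : (A i j <= 1)%N by rewrite /adj /= leq_b1.
have code_w j m : (m <= len)%N ->
    (pattern_code (fun k => A (imem s vL k) j) m < 2 ^ w)%N.
  move=> hm; apply: ltn_trans (pattern_code_lt _) _ => // .
  apply: lt_word_trials; apply: leq_trans (_ : patterns N <= _)%N; last by lia.
  by rewrite leq_exp2l //; lia.
apply: runs_time; last first.
  apply: (@runs_for _ _ _ _ _ _ q _ _ (fun m s' => forall j, (j < m)%N ->
    imem s' vCode j = pattern_code (fun k => A (imem s vL k) j) len)).
  - by [].
  - exact: lt_word.
  - by move=> s1 f; apply: ieval_q; exact: frame_input f _ _ _ _.
  - by [].
  - move=> j s1 jq f hj e.
    have ctx1 : input_kept s1 by exact: frame_input f _ _ _ _.
    have [fi _] := f.
    have hL1 : imem s1 vL = imem s vL by rewrite fi.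
    apply: runs_bind; apply: runs_store; rewrite /= !mod0n hj.
    apply: (@runs_for _ _ _ _ _ _ len _ _ (fun m s' =>
      (forall j', (j' < j)%N -> imem s' vCode j' = imem s1 vCode j') /\
      imem s' vCode j = pattern_code (fun k => A (imem s vL k) j) m)).
    + by [].
    + by apply: lt_word; lia.
    + by move=> s2 [fi2 _]; rewrite ieval_var fi2 //= upd_neq // fi.
    + rewrite /= /upd /= eqxx; split=> // j' hj'.
      by rewrite ltn_eqF.
    + move=> k s2 kl f2 hk [e1 e2]; apply: runs_store.
      have [fi2 _] := f2.
      have ctx2 : input_kept s2.
        by apply: frame_input f2 _ _ _ _ => //; exact: input_kept_store.
      have hL2 : imem s2 vL = imem s vL by rewrite fi2.
      have hj2 : imem s2 vj 0 = j by rewrite fi2.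
      have eA : ieval w s2 (adj_at (IGet vL (var vk)) (var vj)) = A (imem s vL k) j.
        by apply: ieval_adj; rewrite ?ieval_var //= ?mod0n ?hk ?hL2 //; exact: hL.
      have -> : ieval w s2 (IAdd (IMul (ILit 2) (IGet vCode (var vj)))
          (adj_at (IGet vL (var vk)) (var vj))) =
          pattern_code (fun k => A (imem s vL k) j) k.+1.
        have cw := code_w j k.+1 kl.
        transitivity (((2 * imem s2 vCode j) %% 2 ^ w + A (imem s vL k) j) %% 2 ^ w)%N.
          by rewrite -eA /= mod0n mod2w hj2.
        rewrite e2 (modn_small (m := (2 * _)%N)) ?modn_small //.
        by move: cw => /=; lia.
      rewrite ieval_var hj2 /= /upd /= eqxx; split=> // j' hj'.
      by rewrite ltn_eqF // e1.
    + exact: leqnn.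
    move=> s2 _ [e1 e2] j'; rewrite /= /upd /= ltnS leq_eqVlt => /orP[/eqP->|hj'] //.
    by rewrite e1 // e.
  - exact: leqnn.
  - by [].
rewrite /=; by nia.
Qed.

Local Notation width := (q %/ cell_stride N).+1.

(** Since [cell_stride N * width] exceeds q, even an atom containing all columns has its cell
    indices below [cell_stride N]. So code and index can be recovered from the cell number. *)
Lemma atom_rank_div_lt code j : (j < q)%N ->
  (atom_rank code j %/ width < cell_stride N)%N.
Proof.
move=> hj; have hs : (0 < cell_stride N)%N by rewrite !muln_gt0 N0 expn_gt0.
have hr : (atom_rank code j <= j)%N.
  rewrite -[X in (_ <= X)%N]muln1 -[X in (_ <= X * _)%N]card_ord -sum_nat_const.
  by apply: leq_sum => k _; case: (_ == _).
rewrite ltn_divLR // mulnC; apply: leq_ltn_trans hr _; apply: ltn_trans hj _.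
by rewrite {1}(divn_eq q (cell_stride N)) mulSn addnC ltn_add2r ltn_pmod.
Qed.

Lemma cell_lt code j : (code j < patterns N)%N -> (j < q)%N ->
  (code j * cell_stride N + atom_rank code j %/ width < cells N)%N.
Proof.
move=> hc hj; have := atom_rank_div_lt code hj.
have : (code j * cell_stride N + cell_stride N <= cells N)%N.
  by rewrite addnC -mulSn leq_mul2r hc orbT.
by lia.
Qed.

Lemma compute_cells_spec s code : input_kept s ->
  (forall j, (j < q)%N -> imem s vCode j = code j /\ (code j < patterns N)%N) ->
  imem s vR 0 = cell_stride N -> imem s vg 0 = width ->
  runs w compute_cells s (200 * (n * n)) (fun s' => forall j, (j < q)%N ->
    imem s' vCell j = (code j * cell_stride N + atom_rank code j %/ width)%N).
Proof.
move=> ctx hcode hR hg; have [h1 h2 h3 h4 h5] := sizes_lt.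
have hw1 := mod1w; have hnn := nn.
apply: runs_time; last first.
  apply: (@runs_for _ _ _ _ _ _ q _ _ (fun m s' => forall j, (j < m)%N ->
    imem s' vCell j = (code j * cell_stride N + atom_rank code j %/ width)%N)).
  - by [].
  - exact: lt_word.
  - by move=> s1 f; apply: ieval_q; exact: frame_input f _ _ _ _.
  - by [].
  - move=> j s1 jq [fi _] hj e.
    have hC1 : imem s1 vCode = imem s vCode by rewrite fi.
    have hR1 : imem s1 vR 0 = cell_stride N by rewrite fi.
    have hg1 : imem s1 vg 0 = width by rewrite fi.
    apply: runs_bind; apply: runs_zero.
    apply: runs_bind.
    apply: (@runs_for _ _ _ _ _ _ j 40 (q * 60) (fun m s' =>
      imem s' vRank 0 = (\sum_(k < m) (code k == code j))%N)).
    + by [].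
    + by apply: lt_word; lia.
    + by move=> s2 [fi2 _]; rewrite ieval_var fi2.
    + by rewrite /= /upd /= big_ord0.
    + move=> k s2 kj [fi2 _] hk e2.
      have hC2 : imem s2 vCode = imem s vCode by rewrite fi2 //= upd_neq.
      have hj2 : imem s2 vj 0 = j by rewrite fi2 //= upd_neq.
      have [ek _] := hcode k (ltn_trans kj jq); have [ej _] := hcode j jq.
      have sle : (\sum_(k0 < k) (code k0 == code j) <= k)%N.
        rewrite -[X in (_ <= X)%N]muln1 -[X in (_ <= X * _)%N]card_ord -sum_nat_const.
        by apply: leq_sum => k0 _; case: (_ == _).
      apply: (@runs_if _ _ _ _ _ _ 10).
      * rewrite /= !mod0n hk hj2 hC2 ek ej -eqn_leq => hkj.
        apply: runs_time; last apply: runs_setvar; first by [].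
        rewrite /= mod0n hw1 e2 modn_small; last by lia.
        by rewrite /upd /= big_ord_recr /= hkj.
      * rewrite /= !mod0n hk hj2 hC2 ek ej -eqn_leq => hkj.
        by apply: runs_skip => //; rewrite /= /upd /= big_ord_recr /= (negbTE hkj) addn0.
      * by [].
    + by rewrite leq_mul.
    move=> s2 [fi2 _]; rewrite -/(atom_rank code j) => e2; apply: runs_store => j'.
    have hj2 : imem s2 vj 0 = j by rewrite fi2 //= upd_neq.
    have hC2 : imem s2 vCode = imem s vCode by rewrite fi2 //= upd_neq.
    have hR2 : imem s2 vR 0 = cell_stride N by rewrite fi2 //= upd_neq.
    have hg2 : imem s2 vg 0 = width by rewrite fi2 //= upd_neq.
    have hE2 : imem s2 vCell = imem s1 vCell by rewrite fi2 //= upd_neq.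
    have [ej cj] := hcode j jq; have hlt := cell_lt cj jq.
    rewrite /= !mod0n hj2 hC2 ej hR2 hg2 e2 /upd /= ltnS leq_eqVlt.
    case: eqP => [->|_] //= hj'; last by rewrite hE2 e.
    move: hlt; set c := (code j * _)%N; set r := (_ %/ _)%N => hlt.
    rewrite (modn_small (m := c)); last by apply: lt_word_trials; lia.
    by rewrite modn_small //; apply: lt_word_trials; lia.
  - exact: leqnn.
  - by [].
rewrite /=; by nia.
Qed.

Lemma total_edges_spec s : input_kept s ->
  runs w total_edges s (200 * (n * n)) (fun s' =>
    rmem s' rTot 0 = \sum_(i < p) \sum_(j < q) a i j).
Proof.
move=> ctx; have hnn := nn.
apply: runs_time; last first.
  apply: runs_bind; apply: runs_rzero.
  apply: (@runs_for _ _ _ _ _ _ p _ _ (fun m s' =>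
    rmem s' rTot 0 = \sum_(i < m) \sum_(j < q) a i j)).
  - by [].
  - exact: lt_word.
  - by move=> s1 f; apply: ieval_p; exact: frame_input f _ _ _ _.
  - by rewrite /= /upd /= big_ord0.
  - move=> i s1 ip f hi e.
    have ctx1 : input_kept s1 by exact: frame_input f _ _ _ _.
    apply: (@runs_for _ _ _ _ _ _ q _ _ (fun m s' =>
      rmem s' rTot 0 = \sum_(i' < i) \sum_(j < q) a i' j + \sum_(j < m) a i j)).
    + by [].
    + exact: lt_word.
    + by move=> s2 f2; apply: ieval_q; exact: frame_input f2 _ _ _ _.
    + by rewrite /= e big_ord0 addr0.
    + move=> j s2 jq f2 hj e2; apply: runs_rsetvar.
      have ctx2 : input_kept s2 by exact: frame_input f2 _ _ _ _.
      have hi2 : imem s2 vi 0 = i by rewrite f2.1.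
      have eA : ieval w s2 (adj_at (var vi) (var vj)) = A i j.
        by apply: ieval_adj; rewrite ?ieval_var.
      have -> : reval w s2 (RAdd (rvar rTot) (RInt (adj_at (var vi) (var vj)))) =
          rmem s2 rTot 0 + a i j by rewrite /a -eA -(reval_rvar w).
      by rewrite /= /upd /= e2 big_ord_recr /= addrA.
    + exact: leqnn.
    by move=> s2 _ e2; rewrite /= e2 big_ord_recr.
  - exact: leqnn.
  - by [].
rewrite /=; by nia.
Qed.

(** * One trial and the search *)

Definition bit (t c : nat) : nat := ((t %/ 2 %/ 2 ^ c) %% 2)%N.

Lemma bit_le1 t c : (bit t c <= 1)%N.
Proof. by rewrite -ltnS ltn_pmod. Qed.

Lemma read_bits_spec s t : imem s vt 0 = t -> imem s vM 0 = cells N ->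
  runs w read_bits s (100 * (cells N).+1) (fun s' =>
    forall c, (c < cells N)%N -> imem s' vBit c = bit t c).
Proof.
move=> ht hM; have [h1 h2 h3 h4 h5] := sizes_lt; have hw2 := mod2w.
apply: runs_time; last first.
  apply: runs_bind; apply: runs_setvar; rewrite /= mod0n hw2 ht.
  apply: (@runs_for _ _ _ _ _ _ (cells N) _ _ (fun m s' =>
    imem s' vRest 0 = (t %/ 2 %/ 2 ^ m)%N /\
    forall c, (c < m)%N -> imem s' vBit c = bit t c)).
  - by [].
  - by apply: lt_word_trials; lia.
  - by move=> s1 [fi _]; rewrite ieval_var fi.
  - by rewrite /= /upd /= divn1.
  - move=> k s1 _ _ hk [e1 e2].
    apply: runs_bind; apply: runs_store; apply: runs_setvar.
    rewrite /= !mod0n hw2 hk e1 /upd /=; split; first by rewrite e1 expnSr divnMA.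
    move=> c; rewrite ltnS leq_eqVlt; case: eqP => [->|_] //= hc; exact: e2.
  - exact: leqnn.
  - by move=> s1 _ [].
by rewrite /=; lia.
Qed.

Lemma build_W_spec s t cell : input_kept s ->
  (forall c, (c < cells N)%N -> imem s vBit c = bit t c) ->
  (forall j, (j < q)%N -> imem s vCell j = cell j /\ (cell j < cells N)%N) ->
  runs w build_W s (100 * n) (fun s' =>
    (forall j, (j < q)%N -> imem s' 4 j = bit t (cell j)) /\
    imem s' vWc 0 = (\sum_(j < q) bit t (cell j))%N).
Proof.
move=> ctx hb hc; have hnn := nn.
apply: runs_time; last first.
  apply: runs_bind; apply: runs_zero.
  apply: (@runs_for _ _ _ _ _ _ q _ _ (fun m s' =>
    (forall j, (j < m)%N -> imem s' 4 j = bit t (cell j)) /\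
    imem s' vWc 0 = (\sum_(j < m) bit t (cell j))%N)).
  - by [].
  - exact: lt_word.
  - by move=> s1 f; apply: ieval_q; exact: frame_input f _ _ _ _.
  - by rewrite /= /upd /= big_ord0.
  - move=> j s1 jq [fi _] hj [e1 e2].
    have hC1 : imem s1 vCell = imem s vCell by rewrite fi.
    have hB1 : imem s1 vBit = imem s vBit by rewrite fi.
    have [ec lc] := hc j jq.
    have le : (\sum_(j0 < j) bit t (cell j0) <= j)%N.
      rewrite -[X in (_ <= X)%N]muln1 -[X in (_ <= X * _)%N]card_ord -sum_nat_const.
      by apply: leq_sum => k _; exact: bit_le1.
    apply: runs_bind; apply: runs_store; apply: runs_setvar.
    rewrite /= /upd /= !mod0n hj eqxx hC1 hB1 ec hb // e2 modn_small; last first.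
      by have := bit_le1 t (cell j); lia.
    rewrite big_ord_recr /=; split=> // j'; rewrite ltnS leq_eqVlt.
    by case: eqP => [->|_] //= h; exact: e1.
  - exact: leqnn.
  - by move=> s1 _ [].
by rewrite /=; lia.
Qed.

Lemma build_keys_spec s t (wt : nat -> nat) : input_kept s -> imem s vt 0 = t ->
  (forall j, (j < q)%N -> imem s 4 j = wt j /\ (wt j <= 1)%N) ->
  let dg i := (\sum_(j < q) A i j * wt j)%N in
  runs w build_keys s (400 * (n * n)) (fun s' => forall i, (i < p)%N ->
    imem s' vDeg i = dg i /\
    imem s' vKey i = ((if odd t then q - dg i else dg i) * p + i)%N).
Proof.
move=> ctx ht hW dg; have hnn := nn; have hw1 := mod1w; have hw2 := mod2w.
have dg_le i m : (m <= q)%N -> (\sum_(j < m) A i j * wt j <= m)%N.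
  move=> hm; rewrite -[X in (_ <= X)%N]muln1 -[X in (_ <= X * _)%N]card_ord -sum_nat_const.
  apply: leq_sum => k _; have [_ wk] := hW k (leq_trans (ltn_ord k) hm).
  by rewrite -[1%N]muln1; apply: leq_mul => //; rewrite /adj /= leq_b1.
apply: runs_time; last first.
  apply: (@runs_for _ _ _ _ _ _ p _ _ (fun m s' => forall i, (i < m)%N ->
    imem s' vDeg i = dg i /\
    imem s' vKey i = ((if odd t then q - dg i else dg i) * p + i)%N)).
  - by [].
  - exact: lt_word.
  - by move=> s1 f; apply: ieval_p; exact: frame_input f _ _ _ _.
  - by [].
  - move=> i s1 ip f hi e.
    have ctx1 : input_kept s1 by exact: frame_input f _ _ _ _.
    have [fi _] := f.
    apply: runs_bind; apply: runs_store; rewrite /= !mod0n hi.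
    have ctx1' : input_kept (store vDeg i 0 s1) by exact: input_kept_store.
    apply: runs_bind.
    apply: (@runs_for _ _ _ _ _ _ q _ _ (fun m s' =>
      (forall i', (i' < i)%N -> imem s' vDeg i' = imem s1 vDeg i') /\
      imem s' vDeg i = (\sum_(j < m) A i j * wt j)%N)).
    + by [].
    + exact: lt_word.
    + by move=> s2 f2; apply: ieval_q; exact: frame_input f2 _ _ _ _.
    + rewrite /= /upd /= eqxx big_ord0; split=> // i' hi'.
      by rewrite ltn_eqF.
    + move=> j s2 jq f2 hj [e1 e2].
      have ctx2 : input_kept s2 by exact: frame_input f2 _ _ _ _.
      have [fi2 _] := f2.
      have hi2 : imem s2 vi 0 = i by rewrite fi2 //= upd_neq.
      have hW2 : imem s2 4 = imem s 4 by rewrite fi2 //= upd_neq // fi.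
      have [ew wle] := hW j jq.
      have eA : ieval w s2 (adj_at (var vi) (var vj)) = A i j.
        by apply: ieval_adj; rewrite ?ieval_var.
      have Ale : (A i j <= 1)%N by rewrite /adj /= leq_b1.
      have Aw : (A i j * wt j <= 1)%N by rewrite -[1%N]muln1; exact: leq_mul.
      have sle := dg_le i j (ltnW jq).
      apply: runs_store.
      have -> : ieval w s2 (IAdd (IGet vDeg (var vi))
          (IMul (adj_at (var vi) (var vj)) (IGet 4 (var vj)))) =
          (\sum_(j < j.+1) A i j * wt j)%N.
        transitivity ((imem s2 vDeg i + (A i j * imem s2 4 j) %% 2 ^ w) %% 2 ^ w)%N.
          by rewrite -eA /= !mod0n hi2 hj.
        rewrite e2 hW2 ew big_ord_recr /=; move: Aw sle.
        set x := (A i j * wt j)%N; set S := (\sum_(_ < j) _)%N => Aw sle.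
        by rewrite (modn_small (m := x)) ?modn_small //; lia.
      rewrite ieval_var hi2 /= /upd /= eqxx; split=> // i' hi'.
      by rewrite ltn_eqF // e1.
    + exact: leqnn.
    move=> s2 f2 [e1 e2]; apply: runs_store.
    have ctx2 : input_kept s2 by exact: frame_input f2 _ _ _ _.
    have [fi2 _] := f2.
    have hi2 : imem s2 vi 0 = i by rewrite fi2 //= upd_neq.
    have ht2 : imem s2 vt 0 = t by rewrite fi2 //= upd_neq // fi.
    have hK2 : imem s2 vKey = imem s1 vKey by rewrite fi2 //= upd_neq.
    have hp := ieval_p ctx2; have hq := ieval_q ctx2.
    have dle : (dg i <= q)%N by exact: dg_le.
    have kb : ieval w s2 key_base = if odd t then (q - dg i)%N else dg i.
      transitivity ((((t %% 2) * (q - dg i)) %% 2 ^ w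
        + ((1 - t %% 2) * dg i) %% 2 ^ w) %% 2 ^ w)%N.
        by rewrite -hq /= !mod0n hw1 hw2 ht2 hi2 e2.
      rewrite modn2; case: (odd t); rewrite ?mul1n ?mul0n ?mod0n ?addn0 ?add0n ?modn_mod modn_small //.
        by lia.
      by lia.
    have kle : (ieval w s2 key_base <= n)%N.
      by rewrite kb; case: (odd t); lia.
    have -> : ieval w s2 (IAdd (IMul key_base arg_p) (var vi)) =
        ((if odd t then q - dg i else dg i) * p + i)%N.
      have h : (ieval w s2 key_base * p <= n * n)%N by exact: leq_mul.
      transitivity (((ieval w s2 key_base * p) %% 2 ^ w + i) %% 2 ^ w)%N.
        by rewrite -hp -hi2 -[imem s2 vi 0](ieval_var w).
      rewrite -kb; move: h; set x := (ieval w s2 key_base * p)%N => h.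
      by rewrite (modn_small (m := x)) ?modn_small //; lia.
    move=> i'; rewrite ieval_var hi2 /= /upd /= ltnS leq_eqVlt.
    case: eqP => [->|_] //= hi'.
    by rewrite e1 // hK2; exact: e.
  - exact: leqnn.
  - by [].
by rewrite /=; nia.
Qed.

Definition threshold : R := (1 - half_alpha) * eps * p%:R.

Lemma rank_sum (ky : nat -> nat) (i : 'I_p) :
  rank [set: 'I_p] (fun k : 'I_p => ky k) i = (\sum_(k < p) (ky k < ky i))%N.
Proof.
rewrite /rank -sum1_card big_mkcond /=; apply: eq_bigr => k _.
by rewrite !inE /=; case: (_ < _)%N.
Qed.

Lemma build_U_spec s (ky dg : nat -> nat) : input_kept s ->
  (forall i, (i < p)%N -> imem s vDeg i = dg i /\ imem s vKey i = ky i) ->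
  rmem s rAl 0 = half_alpha ->
  let U := lowest (fun i : 'I_p => ky i) threshold in
  runs w build_U s (400 * (n * n)) (fun s' =>
    [/\ output_U p s' = U, imem s' vUc 0 = #|U| &
        rmem s' rEdges 0 = \sum_(i in U) (dg i)%:R]).
Proof.
move=> ctx hK hal U; have hnn := nn; have hw1 := mod1w.
pose rk i := (\sum_(k < p) (ky k < ky i))%N.
pose inU i := (rk i == 0%N) || ((rk i)%:R < threshold).
have inUE (i : 'I_p) : (i \in U) = inU i by rewrite inE rank_sum.
have sum_le (b : nat -> bool) m : (\sum_(k < m) b k <= m)%N.
  rewrite -[X in (_ <= X)%N]muln1 -[X in (_ <= X * _)%N]card_ord -sum_nat_const.
  by apply: leq_sum => k _; case: (b k).
apply: runs_time; last first.
  apply: runs_bind; apply: runs_zero.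
  apply: runs_bind; apply: runs_rzero.
  apply: (@runs_for _ _ _ _ _ _ p _ _ (fun m s' =>
    [/\ forall i, (i < m)%N -> (imem s' 3 i != 0%N) = inU i,
        imem s' vUc 0 = (\sum_(i < m) inU i)%N &
        rmem s' rEdges 0 = \sum_(i < m) (inU i * dg i)%:R])).
  - by [].
  - exact: lt_word.
  - by move=> s1 f; apply: ieval_p; exact: frame_input f _ _ _ _.
  - by rewrite /= /upd /= !big_ord0.
  - move=> i s1 ip f hi [e1 e2 e3].
    have ctx1 : input_kept s1 by exact: frame_input f _ _ _ _.
    have [fi fr] := f.
    have [di ki] := hK i ip.
    apply: runs_bind; apply: runs_zero.
    apply: runs_bind.
    apply: (@runs_for _ _ _ _ _ _ p _ _ (fun m s' =>
      imem s' vRank 0 = (\sum_(k < m) (ky k < ky i))%N)).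
    + by [].
    + exact: lt_word.
    + by move=> s2 f2; apply: ieval_p; exact: frame_input f2 _ _ _ _.
    + by rewrite /= /upd /= big_ord0.
    + move=> k s2 kp [fi2 _] hk e.
      have hi2 : imem s2 vi 0 = i by rewrite fi2 //= upd_neq.
      have hK2 : imem s2 vKey = imem s vKey by rewrite fi2 //= upd_neq // fi.
      have [_ kk] := hK k kp.
      have sle := sum_le (fun k => ky k < ky i)%N k.
      apply: (@runs_if _ _ _ _ _ _ 10).
      * rewrite beval_blt /= !mod0n hk hi2 hK2 kk ki => lt.
        apply: runs_time; last apply: runs_setvar; first by [].
        rewrite /= mod0n hw1 e modn_small; last by lia.
        by rewrite /upd /= big_ord_recr /= lt addn1.
      * rewrite beval_blt /= !mod0n hk hi2 hK2 kk ki => /negbTE lt.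
        by apply: runs_skip => //; rewrite /= /upd /= big_ord_recr /= lt addn0.
      * exact: leqnn.
    + exact: leqnn.
    move=> s2 f2 e.
    have ctx2 : input_kept s2 by exact: frame_input f2 _ _ _ _.
    have [fi2 fr2] := f2; have [_ _ r2] := ctx2.
    have hi2 : imem s2 vi 0 = i by rewrite fi2 //= upd_neq.
    have hU2 : imem s2 3 = imem s1 3 by rewrite fi2 //= upd_neq.
    have hUc2 : imem s2 vUc 0 = imem s1 vUc 0 by rewrite fi2 //= upd_neq.
    have hE2 : rmem s2 rEdges 0 = rmem s1 rEdges 0 by rewrite fr2.
    have hD2 : imem s2 vDeg = imem s vDeg by rewrite fi2 //= upd_neq // fi.
    have hal2 : rmem s2 rAl 0 = half_alpha by rewrite fr2 // fr.
    have hp := ieval_p ctx2.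
    have cond : beval w s2 (BAnd (BLei (ILit 1) (var vRank))
        (BLer (RMul slack (RInt arg_p)) (RInt (var vRank)))) = ~~ inU i.
      transitivity ((1 <= rk i)%N && (threshold <= (rk i)%:R)).
        by rewrite /threshold -hp -hal2 /= !mod0n hw1 e r2.
      by rewrite /inU negb_or -lt0n -leNgt.
    have Ucle := sum_le inU i.
    apply: (@runs_if _ _ _ _ _ _ 60).
    + rewrite cond => /negbTE out; apply: runs_time; last apply: runs_store; first by [].
      rewrite /= /upd /= !mod0n hi2 !big_ord_recr /= out mul0n addr0 addn0.
      split; rewrite ?hUc2 ?hE2 // => i'; rewrite ltnS leq_eqVlt.
      by case: eqP => [->|_] //= h; rewrite ?out // hU2 e1.
    + rewrite cond negbK => inn; apply: runs_time; last first.
        apply: runs_bind; apply: runs_store.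
        apply: runs_bind; apply: runs_setvar.
        apply: runs_rsetvar; rewrite /= /upd /= !mod0n hw1 hi2.
        rewrite hUc2 hE2 hD2 di e2 e3 modn_small; last by lia.
        rewrite !big_ord_recr /= inn mul1n; split=> // i'; rewrite ltnS leq_eqVlt.
        by case: eqP => [->|_] //= h; rewrite ?inn // hU2 e1.
      by [].
    + exact: leqnn.
  - exact: leqnn.
  - move=> s1 _ [e1 e2 e3]; split.
    + by apply/setP => i; rewrite inUE inE e1.
    + rewrite e2 -sum1_card [RHS]big_mkcond /=; apply: eq_bigr => i _.
      by rewrite inUE; case: (inU i).
    + rewrite e3 [RHS]big_mkcond /=; apply: eq_bigr => i _.
      by rewrite inUE; case: (inU i); rewrite ?mul1n ?mul0n.
rewrite /=; by nia.
Qed.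

Lemma test_witness_spec s (U : {set 'I_p}) (W : {set 'I_q}) : input_kept s ->
  imem s vUc 0 = #|U| -> imem s vWc 0 = #|W| ->
  rmem s rEdges 0 = (edge_count G U W)%:R ->
  rmem s rTot 0 = (edge_count G [set: 'I_p] [set: 'I_q])%:R ->
  rmem s rAl 0 = half_alpha -> imem s 2 0 = 0%N ->
  runs w test_witness s 200 (fun s' =>
    if imem s' 2 0 == 0%N then ~ irregularity_witness G eps half_alpha U W
    else irregularity_witness G eps half_alpha U W).
Proof.
move=> ctx hU hW hE hT hal hv; have hw1 := mod1w.
have [_ _ r0] := ctx; have hp := ieval_p ctx; have hq := ieval_q ctx.
set dev := density R G U W - density R G [set: 'I_p] [set: 'I_q].
have eslack : reval w s slack = (1 - half_alpha) * eps.
  by rewrite /= !mod0n hw1 hal r0.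
have edev : reval w s deviation = dev.
  transitivity (rmem s rEdges 0 / ((imem s vUc 0)%:R * (imem s vWc 0)%:R)
    - rmem s rTot 0 / ((ieval w s arg_p)%:R * (ieval w s arg_q)%:R)).
    by rewrite /= !mod0n.
  by rewrite hE hT hU hW hp hq /dev /density !cardsT !card_ord.
set c := (1 - half_alpha) * eps in eslack *.
have cond : beval w s (BAnd (BLei (ILit 1) (var vUc)) (BAnd (BLei (ILit 1) (var vWc))
     (BAnd (BLer (RMul slack (RInt arg_p)) (RInt (var vUc)))
     (BAnd (BLer (RMul slack (RInt arg_q)) (RInt (var vWc)))
           (BNot (BAnd (BLer deviation slack)
                       (BLer (RSub (RInt (ILit 0)) deviation) slack))))))) =
    [&& (1 <= #|U|)%N, (1 <= #|W|)%N, c * p%:R <= #|U|%:R, c * q%:R <= #|W|%:R &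
      ~~ ((dev <= c) && (- dev <= c))].
  transitivity [&& (1 %% 2 ^ w <= imem s vUc 0)%N, (1 %% 2 ^ w <= imem s vWc 0)%N,
      reval w s slack * (ieval w s arg_p)%:R <= (imem s vUc 0)%:R,
      reval w s slack * (ieval w s arg_q)%:R <= (imem s vWc 0)%:R &
      ~~ ((reval w s deviation <= reval w s slack) &&
          (0 - reval w s deviation <= reval w s slack))].
    by rewrite /= !mod0n.
  by rewrite hw1 eslack edev hp hq hU hW sub0r.
have normE : (dev <= c) && (- dev <= c) = (`|dev| <= c).
  by rewrite ler_norml andbC lerNl.
apply: (@runs_if _ _ _ _ _ _ 10) => //.
- rewrite cond normE -ltNge => /and5P[h1 h2 h3 h4 h5].
  apply: runs_time; last apply: runs_setvar; first by [].
  by rewrite /= /upd /= hw1 /=; split; rewrite ?card_ord // -!card_gt0.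
- rewrite cond normE -ltNge => hn; apply: runs_skip => //; rewrite hv /=.
  move=> [[h1 h2] h3 h4 h5]; rewrite !card_ord in h3 h4.
  by move/negP: hn; apply; rewrite !card_gt0 h1 h2 h3 h4.
Qed.

Definition trial_W (cell : nat -> nat) (t : nat) : {set 'I_q} :=
  [set j : 'I_q | bit t (cell j) != 0%N].

Definition trial_degree (cell : nat -> nat) (t i : nat) : nat :=
  (\sum_(j < q) A i j * bit t (cell j))%N.

(* Adding [i] makes the keys distinct. *)
Definition trial_key (cell : nat -> nat) (t i : nat) : nat :=
  ((if odd t then q - trial_degree cell t i else trial_degree cell t i) * p + i)%N.

Definition trial_U (cell : nat -> nat) (t : nat) : {set 'I_p} :=
  lowest (fun i : 'I_p => trial_key cell t i) threshold.

Lemma bit_boolE t c : bit t c = (bit t c != 0%N).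
Proof. by have := bit_le1 t c; case: (bit t c) => [|[|]]. Qed.

Lemma trial_degreeE cell t (i : 'I_p) : trial_degree cell t i = degree G (trial_W cell t) i.
Proof.
rewrite /trial_degree /degree [RHS]big_mkcond /=; apply: eq_bigr => j _.
by rewrite adjE bit_boolE inE; case: (_ != _); rewrite ?muln1 ?muln0.
Qed.

Lemma card_trial_W cell t : #|trial_W cell t| = (\sum_(j < q) bit t (cell j))%N.
Proof.
rewrite -sum1_card big_mkcond /=; apply: eq_bigr => j _.
by rewrite inE [RHS]bit_boolE; case: (_ != _).
Qed.

Lemma edge_count_degree (U : {set 'I_p}) (W : {set 'I_q}) :
  (edge_count G U W)%:R = \sum_(i in U) (degree G W i)%:R :> R.
Proof. by rewrite edge_countE; apply: eq_bigr => i _; rewrite natr_sum. Qed.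

Lemma total_edgesE :
  \sum_(i < p) \sum_(j < q) a i j = (edge_count G [set: 'I_p] [set: 'I_q])%:R.
Proof.
rewrite edge_countE; apply: eq_big => [i|i _]; first by rewrite inE.
by apply: eq_big => [j|j _]; rewrite ?inE // /a adjE.
Qed.

Lemma trial_spec s t cell : input_kept s -> imem s vt 0 = t -> imem s vM 0 = cells N ->
  (forall j, (j < q)%N -> imem s vCell j = cell j /\ (cell j < cells N)%N) ->
  rmem s rTot 0 = \sum_(i < p) \sum_(j < q) a i j -> rmem s rAl 0 = half_alpha ->
  imem s 2 0 = 0%N ->
  runs w trial s (100 * cells N + 1200 * (n * n)) (fun s' =>
    if imem s' 2 0 == 0%N
    then ~ irregularity_witness G eps half_alpha (trial_U cell t) (trial_W cell t)
    else irregularity_witness G eps half_alpha (output_U p s') (output_W q s')).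
Proof.
move=> ctx ht hM hcell hT hal hv; have hnn := nn.
apply: runs_time; last first.
  apply: runs_bind; apply: runs_conseq (read_bits_spec ht hM) _ => s1 f1 hb.
  have ctx1 : input_kept s1 by exact: frame_input f1 _ _ _ _.
  have [fi1 fr1] := f1.
  apply: runs_bind; apply: runs_conseq.
    by apply: (@build_W_spec _ t cell) => //; move=> j jq; rewrite fi1 //; exact: hcell.
  move=> s2 f2 [hW hWc].
  have ctx2 : input_kept s2 by exact: frame_input f2 _ _ _ _.
  have [fi2 fr2] := f2.
  apply: runs_bind; apply: runs_conseq.
    apply: (@build_keys_spec _ t (fun j => bit t (cell j))) => //.
      by rewrite fi2 // fi1.
    by move=> j jq; rewrite hW // bit_le1.
  rewrite /= => s3 f3 hK.
  have ctx3 : input_kept s3 by exact: frame_input f3 _ _ _ _.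
  have [fi3 fr3] := f3.
  apply: runs_bind; apply: runs_conseq.
    apply: (@build_U_spec _ (trial_key cell t) (trial_degree cell t)) => //.
    by rewrite fr3 // fr2 // fr1.
  rewrite -/(trial_U cell t) => s4 f4 [hU hUc hE].
  have ctx4 : input_kept s4 by exact: frame_input f4 _ _ _ _.
  have [fi4 fr4] := f4.
  have outW4 : output_W q s4 = trial_W cell t.
    by apply/setP => j; rewrite !inE fi4 // fi3 // hW.
  apply: runs_conseq.
    apply: (@test_witness_spec _ (trial_U cell t) (trial_W cell t)) => //.
    - by rewrite fi4 // fi3 // hWc card_trial_W.
    - rewrite hE edge_count_degree; apply: eq_bigr => i _.
      by rewrite trial_degreeE.
    - by rewrite fr4 // fr3 // fr2 // fr1 // hT total_edgesE.
    - by rewrite fr4 // fr3 // fr2 // fr1.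
    - by rewrite fi4 // fi3 // fi2 // fi1.
  move=> s5 f5 hw5.
  have [fi5 _] := f5.
  have -> : output_U p s5 = trial_U cell t.
    by rewrite -hU; apply/setP => i; rewrite !inE fi5.
  have -> : output_W q s5 = trial_W cell t.
    by rewrite -outW4; apply/setP => j; rewrite !inE fi5.
  exact: hw5.
by lia.
Qed.

Lemma search_spec s cell : input_kept s -> imem s vM 0 = cells N ->
  imem s vTrials 0 = trials N ->
  (forall j, (j < q)%N -> imem s vCell j = cell j /\ (cell j < cells N)%N) ->
  rmem s rTot 0 = \sum_(i < p) \sum_(j < q) a i j -> rmem s rAl 0 = half_alpha ->
  imem s 2 0 = 0%N ->
  runs w search s ((trials N).+1 * (100 * cells N + 1300 * (n * n))) (fun s' =>
    if imem s' 2 0 == 0%N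
    then forall t, (t < trials N)%N ->
      ~ irregularity_witness G eps half_alpha (trial_U cell t) (trial_W cell t)
    else irregularity_witness G eps half_alpha (output_U p s') (output_W q s')).
Proof.
move=> ctx hM hTr hcell hT hal hv; have hnn := nn.
apply: (@runs_for _ _ _ _ _ _ (trials N) (100 * cells N + 1200 * (n * n) + 20) _
  (fun m s' => if imem s' 2 0 == 0%N
    then forall t, (t < m)%N ->
      ~ irregularity_witness G eps half_alpha (trial_U cell t) (trial_W cell t)
    else irregularity_witness G eps half_alpha (output_U p s') (output_W q s'))).
- by [].
- by apply: lt_word_trials; lia.
- by move=> s1 [fi _]; rewrite ieval_var fi.
- by rewrite /= /upd /= hv.
- move=> t s1 lt f1 ht h.
  have ctx1 : input_kept s1 by exact: frame_input f1 _ _ _ _.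
  have [fi1 fr1] := f1.
  apply: (@runs_if _ _ _ _ _ _ (100 * cells N + 1200 * (n * n))).
  + rewrite /= !mod0n leqn0 => /eqP v1; rewrite v1 /= in h.
    apply: runs_conseq.
      apply: (@trial_spec _ t cell) => //; rewrite ?fi1 ?fr1 //.
    move=> s2 _; rewrite /= /upd /=; case: ifP => // _ hn t'.
    by rewrite ltnS leq_eqVlt => /orP[/eqP->|]; [exact: hn | exact: h].
  + rewrite /= !mod0n leqn0 => v1; rewrite (negbTE v1) in h.
    by apply: runs_skip; [lia | rewrite /= /upd /= (negbTE v1)].
  + by rewrite /=; lia.
- by rewrite /= leq_mul2l; apply/orP; right; lia.
- by [].
Qed.

(** * Completeness of the search and the total time *)

Lemma half_alpha_bounds : 0 < alpha ->
  [/\ 0 < half_alpha, half_alpha <= 1 / 2 & half_alpha <= alpha].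
Proof.
move=> h; rewrite /half_alpha.
by case: (lerP (1 / 2) alpha) => h'; split=> //; lra.
Qed.

Lemma bits_exist (P : nat -> bool) m : exists2 x, (x < 2 ^ m)%N &
  forall c, (c < m)%N -> ((x %/ 2 ^ c) %% 2)%N = P c.
Proof.
elim: m P => [|m IH] P; first by exists 0%N.
have [x xm hx] := IH (fun c => P c.+1).
exists (2 * x + P 0%N)%N; first by rewrite expnS; case: (P 0%N); lia.
case=> [|c] hc; first by rewrite divn1 mulnC modnMDl modn_small //; case: (P 0%N).
by rewrite expnS divnMA mulnC divnMDl // (divn_small (m := P 0%N)) ?addn0 ?hx //; case: (P 0%N).
Qed.

Lemma radix_le (x x' : nat) (i i' : 'I_p) : (x * p + i < x' * p + i')%N -> (x <= x')%N.
Proof.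
move=> h; rewrite leqNgt; apply/negP => hx.
have : (x'.+1 * p <= x * p)%N by rewrite leq_mul2r hx orbT.
by rewrite mulSn; have := ltn_ord i'; lia.
Qed.

(** The trial selects cell c exactly if its index c mod stride is below the value of [f] at its atom
    c / stride; its lowest bit is [flip]. *)
Lemma trial_exists (code : nat -> nat) (f : nat -> nat) (flip : bool) :
  (forall j, (j < q)%N -> (code j < patterns N)%N) ->
  let cell j := (code j * cell_stride N + atom_rank code j %/ width)%N in
  exists2 t, (t < trials N)%N &
    odd t = flip /\ trial_W cell t = cells_below q code width f.
Proof.
move=> hc cell.
have s0 : (0 < cell_stride N)%N by rewrite !muln_gt0 N0 expn_gt0.
have [x xm hx] := bits_exist
  (fun c => (c %% cell_stride N < f (c %/ cell_stride N))%N) (cells N).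
exists (x * 2 + flip)%N.
  by rewrite /trials expnS; case: flip; lia.
split; first by rewrite oddD oddM andbF; case: flip.
apply/setP => j; rewrite !inE /bit divnMDl // (divn_small (m := flip)) ?addn0; last by case: flip.
have rlt := atom_rank_div_lt code (ltn_ord j).
rewrite hx; last by apply: cell_lt => //; exact: hc.
rewrite /cell modnMDl modn_small // divnMDl // (divn_small rlt) addn0.
by case: (_ < _)%N.
Qed.

(** By contraposition: a pair of deviation at least eps is rounded by [cells_approximate], turned
    into a witness by [irregular_found], and met by the search by [trial_exists]. *)
Lemma all_trials_fail (code L : nat -> nat) (len : nat) (om : R) :
  0 < eps -> 0 < alpha ->
  (forall j, (j < q)%N -> (code j < patterns N)%N) ->
  (forall (k : nat) (j j' : 'I_q), (k < len)%N -> code j = code j' -> a (L k) j = a (L k) j') ->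
  \sum_t `|gram a (q := q) id p t - om * gram a L len t| <=
    halving_potential R (sparse_size N) p (sparse_size N) * q%:R ^+ 2 ->
  let cell j := (code j * cell_stride N + atom_rank code j %/ width)%N in
  (forall t, (t < trials N)%N ->
     ~ irregularity_witness G eps half_alpha (trial_U cell t) (trial_W cell t)) ->
  regular_bigraph G eps.
Proof.
move=> e0 alpha0 hc sep hE cell fail Us Ws _ _ hU hW.
have [al0 al1 _] := half_alpha_bounds alpha0.
rewrite !cardsT !card_ord in hU hW.
rewrite ltNge; apply/negP => hd.
have NR : 0 < N%:R :> R by rewrite ltr0n.
have [q0|q0] := posnP q.
  have z : (p == 0)%N || (q == 0)%N by rewrite q0 eqxx orbT.
  by move: hd; rewrite !(density_full_empty _ _ z) subrr normr0; lra.
have hE' : \sum_t `|gram a (q := q) id p t - om * gram a L len t| <=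
    p%:R * q%:R ^+ 2 / (16 * N%:R ^+ 2).
  apply: le_trans hE _; rewrite mulrAC; apply: ler_wpM2r; first exact: sqr_ge0.
  have m0 : (0 < 400 * N * N)%N by rewrite !muln_gt0 N0.
  apply: le_trans (halving_potential_init R p m0) _.
  rewrite -mulrA; apply: ler_wpM2l => //.
  rewrite !natrM ler_pdivrMr ?mulr_gt0 //.
  (* The potential contributes 24, so 400 / 16 = 25 is enough. *)
  have -> : (16 * N%:R ^+ 2)^-1 * (400 * N%:R * N%:R) = 25 :> R.
    by field; rewrite gt_eqF.
  by rewrite ler_nat.
have [f [WWs WsW hS]] := cells_approximate a01 hc Ws q0 N0 sep hE'.
have sumG (U : {set 'I_p}) (W : {set 'I_q}) : \sum_(i in U) \sum_(j in W) a i j =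
    \sum_(i in U) \sum_(j in W) (G i j)%:R.
  by apply: eq_bigr => i _; apply: eq_bigr => j _; rewrite /a adjE.
have [|flip found] := irregular_found e0 al0 al1 N_scale hU hW hd WWs WsW.
  by rewrite -!sumG; exact: hS.
have [t tlt [ht tW]] := trial_exists f flip hc.
apply: (fail t tlt); rewrite tW; apply: found.
- move=> i i' h; apply/val_inj; move/(congr1 (modn^~ p)): h.
  by rewrite /trial_key !modnMDl !modn_small.
- move=> i i'; rewrite /trial_key ht -tW -!trial_degreeE -/cell.
  set d := trial_degree _ _ i; set d' := trial_degree _ _ i'.
  have dq k : (trial_degree cell t k <= q)%N.
    rewrite -[X in (_ <= X)%N]muln1 -[X in (_ <= X * _)%N]card_ord -sum_nat_const.
    by apply: leq_sum => j _; rewrite -[1%N]muln1 leq_mul ?bit_le1 // /adj /= leq_b1.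
  by case: flip {ht} => /radix_le; rewrite ?leq_sub2lE //; exact: dq.
Qed.

Lemma algorithm_spec : 0 < eps -> 0 < alpha ->
  runs w algorithm inp (100 * 100 * (trials N * trials N) * (n * n))
    (fun s' => correct_output G eps alpha s').
Proof.
move=> e0 alpha0; have hnn := nn; have [h1 h2 h3 h4 h5] := sizes_lt.
have X0 : (0 < trials N)%N by rewrite expn_gt0.
apply: runs_time; last first.
  have ctx : input_kept inp by [].
  apply: runs_bind; apply: runs_conseq (find_scale_spec ctx) _ => s1 f1 [hN hal].
  have ctx1 : input_kept s1 by exact: frame_input f1 _ _ _ _.
  have [fi1 fr1] := f1.
  apply: runs_bind; apply: runs_conseq (init_rows_spec ctx1 hN) _ => s2 f2 [hK hB hLen hL].
  have ctx2 : input_kept s2 by exact: frame_input f2 _ _ _ _.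
  have [fi2 fr2] := f2.
  have hN2 : imem s2 vN 0 = N by rewrite fi2.
  apply: runs_bind; apply: runs_conseq (init_sizes_spec ctx2 hN2 hK) _ => s3 f3 [hR hg hM hTr].
  have ctx3 : input_kept s3 by exact: frame_input f3 _ _ _ _.
  have [fi3 fr3] := f3.
  apply: runs_bind; apply: runs_conseq.
    apply: (@sparsify_spec (sparse_size N) p (sparse_size N)) => //; rewrite ?fi3 //; try by lia.
      by rewrite mulnC; apply: lt_word_N; lia.
    by move=> k kp; rewrite hL.
  move=> s4 f4 [om [len_le len_p hL4 hE]].
  have ctx4 : input_kept s4 by exact: frame_input f4 _ _ _ _.
  have [fi4 fr4] := f4.
  apply: runs_bind; apply: runs_conseq.
    by apply: (@compute_codes_spec _ (imem s4 vLen 0)).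
  set L := imem s4 vL in hL4 hE *; set len := imem s4 vLen 0 in len_le len_p hL4 hE *.
  pose code j := pattern_code (fun k => A (L k) j) len.
  move=> s5 f5 hcode.
  have ctx5 : input_kept s5 by exact: frame_input f5 _ _ _ _.
  have [fi5 fr5] := f5.
  have code_lt j : (code j < patterns N)%N.
    apply: leq_trans (pattern_code_lt _) _; first by move=> k _; rewrite /adj /= leq_b1.
    by rewrite leq_exp2l.
  apply: runs_bind; apply: runs_conseq.
    apply: (@compute_cells_spec _ code) => //.
    - by move=> j jq; rewrite hcode.
    - by rewrite fi5 // fi4.
    - by rewrite fi5 // fi4.
  move=> s6 f6 hcell.
  have ctx6 : input_kept s6 by exact: frame_input f6 _ _ _ _.
  have [fi6 fr6] := f6.
  apply: runs_bind; apply: runs_conseq (total_edges_spec ctx6) _ => s7 f7 hT.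
  have ctx7 : input_kept s7 by exact: frame_input f7 _ _ _ _.
  have [fi7 fr7] := f7.
  apply: runs_conseq.
    apply: (@search_spec _
      (fun j => code j * cell_stride N + atom_rank code j %/ width)%N) => //.
    - by rewrite fi7 // fi6 // fi5 // fi4.
    - by rewrite fi7 // fi6 // fi5 // fi4.
    - move=> j jq; split; first by rewrite fi7 // hcell.
      exact: cell_lt.
    - by rewrite fr7 // fr6 // fr5 // fr4 // fr3 // fr2.
    - by rewrite fi7 // fi6 // fi5 // fi4 // fi3 // fi2 // fi1.
  move=> s8 _; rewrite /correct_output /claims_regular; case: ifP => _.
  - apply: (@all_trials_fail code L len om) => //.
    + move=> s j j' hs /pattern_code_inj h; rewrite /a; congr (_%:R).
      by apply: h => // k; rewrite /adj /= leq_b1.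
    + apply: le_trans hE; apply: ler_sum => t _.
      rewrite (_ : gram a id p t = gram a (imem s3 vL) p t) //.
      by apply: eq_bigr => k _; rewrite fi3 // hL.
  - have [_ _ le_al] := half_alpha_bounds alpha0.
    have le : (1 - alpha) * eps <= (1 - half_alpha) * eps.
      by rewrite ler_wpM2r ?(ltW e0) // lerD2l lerN2.
    case=> ne hU hW hd; split=> //.
    + by apply: le_trans hU; rewrite ler_wpM2r.
    + by apply: le_trans hW; rewrite ler_wpM2r.
    + exact: le_lt_trans hd.
rewrite /=; set X := trials N in h5 X0 *; set Y := (X * X * (n * n))%N.
have XY : (X * (n * n) <= Y)%N by rewrite /Y leq_mul2r leq_pmulr // orbT.
have nY : (n * n <= X * (n * n))%N by rewrite leq_pmull.
have X_le : (X <= X * (n * n))%N by rewrite leq_pmulr // muln_gt0 n0.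
have sp : (p * sparse_size N * n <= X * (n * n))%N.
  by rewrite (mulnC p) -mulnA; apply: leq_mul; [lia | exact: leq_mul].
have sc : (n * (sparse_size N).+1 <= X * (n * n))%N.
  by rewrite mulnC; apply: leq_mul; lia.
(* The search dominates. Bounding [cells N] by the number of trials makes its time quadratic in that
   number. *)
have ss : (X.+1 * (100 * cells N + 1300 * (n * n)) <= 2800 * Y)%N.
  apply: leq_trans (_ : (2 * X) * (1400 * (X * (n * n))) <= _)%N.
    by apply: leq_mul; lia.
  by rewrite /Y; lia.
have -> : (100 * 100 * (X * X) * (n * n) = 100 * 100 * Y)%N by rewrite /Y !mulnA.
clearbody Y; lia.
Qed.

End Programs.

(* The real RAM has words of any length w with 2 ^ w >= C * n ^ k, that is,
   of k * log2 n + O(1) bits; k is a constant of the algorithm. *)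
Theorem theorem1p2 (R : realType) :
  exists (algo : cmd) (k : nat),
  forall eps alpha : R, 0 < eps -> 0 < alpha ->
  exists C : nat,
  forall (n p q : nat) (G : 'I_p -> 'I_q -> bool) (w : nat),
    (0 < n)%N -> (p <= n)%N -> (q <= n)%N -> (C * n ^ k <= 2 ^ w)%N ->
  exists (s : state R) (t : nat),
    [/\ exec w algo (input_state G eps alpha) s t,
        (t <= C * n ^ 2)%N &
        correct_output G eps alpha s].
Proof.
exists algorithm, 2%N => eps alpha e0 alpha0.
have [al0 _ _] := half_alpha_bounds alpha0.
have b0 : 0 < eps * eps * eps * half_alpha alpha by rewrite !mulr_gt0.
(* The Archimedean property yields some scale; the least one is where the counting loop stops. *)
have ex : exists m, (0 < m)%N && (1 <= m%:R * (eps * eps * eps * half_alpha alpha)).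
  set b := (eps * eps * eps * half_alpha alpha) in b0 *.
  have bi : 0 < b^-1 by rewrite invr_gt0.
  exists (Num.bound b^-1); have lt := archi_boundP (ltW bi).
  rewrite -(ltr_nat R) (lt_trans bi lt) /=.
  by rewrite -ler_pdivrMr // mul1r ltW.
case: (ex_minnP ex) => N /andP[N0 N_scale] N_min.
have X0 : (0 < trials N)%N by rewrite expn_gt0.
(* One constant serves as time bound and as word-size requirement; it depends only on N, hence on
   eps and alpha. *)
exists (100 * 100 * (trials N * trials N))%N => n p q G w n0 pn qn hw.
rewrite -mulnn in hw.
have XX : (trials N <= trials N * trials N)%N by rewrite leq_pmulr.
have nX : (trials N * (n * n) <= trials N * trials N * (n * n))%N by rewrite leq_mul2r XX orbT.
have nn0 : (n * n <= trials N * (n * n))%N by rewrite leq_pmull.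
have [s' [t [h1 h2 h3]]] : runs w algorithm (input_state G eps alpha)
    (100 * 100 * (trials N * trials N) * (n * n)) (fun s' => correct_output G eps alpha s').
  apply: algorithm_spec => //; try by lia.
  by move=> m m0 hm; apply: N_min; rewrite m0 hm.
by exists s', t; rewrite -mulnn.
Qed.
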